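(* Let $S^6\subset\mathbb{R}^7$ be the unit sphere with its standard round metric and Levi-Civita connection $\nabla$. There is no almost complex structure $J$ on $S^6$ such that, at every point and for every tangent vector $X$ at that point, the endomorphisms $\nabla_X J$ and $\nabla_{JX}J$ commute.
   Context: An almost complex structure on a smooth manifold $M$ is a smooth section $J$ of $\operatorname{End}(TM)$ with $J^2=-\operatorname{Id}$. The connection $\nabla$ on the tangent bundle induces a connection on $\operatorname{End}(TM)$, also denoted $\nabla$, by $(\nabla_X J)Y=\nabla_X(JY)-J\nabla_XY$. No integrability or orthogonality of $J$ is assumed. *)

(* Defs.v *)
From HB Require Import structures.
From mathcomp Require Import all_boot all_order all_algebra.
From mathcomp Require Import all_classical all_reals all_analysis.

Set Implicit Arguments.
Unset Strict Implicit.
Unset Printing Implicit Defensive.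
Import Order.TTheory GRing.Theory Num.Theory.
Import numFieldNormedType.Exports.
Local Open Scope classical_set_scope.
Local Open Scope ring_scope.

Definition dot (R : realType) (n : nat) (u v : 'cV[R]_n) : R :=
  \sum_(i < n) u i 0 * v i 0.

(* C^k on U: [f] is differentiable at every point of [U] and its differential
   is C^(k-1); as the domain is meant to be finite dimensional, the latter is
   tested on each vector [v] separately. *)
Fixpoint Ck (R : realType) (V W : normedModType R) (k : nat) (U : set V)
    (f : V -> W) : Prop :=
  match k with
  | 0%N => forall x, U x -> {for x, continuous f}
  | k'.+1 => (forall x, U x -> differentiable f x) /\
             (forall v : V, Ck k' U (fun x => 'd f x v))
  end.

Definition Csmooth (R : realType) (V W : normedModType R) (U : set V)
  (f : V -> W) : Prop := forall k, Ck k U f.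

(* The unit sphere S^n in R^(n+1), whose points are column vectors. *)
Definition sphere (R : realType) (n : nat) : Type :=
  {x : 'cV[R]_n.+1 | dot x x == 1}.

Section Sphere.
Variables (R : realType) (n : nat).
Implicit Types (p q : sphere R n) (v w : 'cV[R]_n.+1).

Definition tangent p v : Prop := dot (val p) v = 0.

(* Smooth maps on S^n as a submanifold of R^(n+1): those which extend smoothly
   to an open neighbourhood of each point. *)
Definition smooth_map (W : normedModType R) (f : sphere R n -> W) : Prop :=
  forall p, exists (U : set 'cV[R]_n.+1) (F : 'cV[R]_n.+1 -> W),
    [/\ open U, U (val p), Csmooth U F
      & forall q, U (val q) -> F (val q) = f q].

(* The differential df_p(v), for v tangent at p, computed as the derivative at p
   along v of the extension x |-> f (x / |x|); see [dsphere_ext]. The default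
   value given to [insubd] only matters at x = 0. *)
Definition dsphere (W : normedModType R) (f : sphere R n -> W) p v : W :=
  'D_v (fun x : 'cV[R]_n.+1 => f (insubd p ((Num.sqrt (dot x x))^-1 *: x)))
    (val p).

Definition vector_field (X : sphere R n -> 'cV[R]_n.+1) : Prop :=
  smooth_map X /\ forall p, tangent p (X p).

(* An affine connection on the tangent bundle: [nabla p v Y] is the covariant
   derivative at p of the vector field Y in the direction v. Only its values on
   tangent vectors v and vector fields Y are constrained. *)
Definition connection :=
  sphere R n -> 'cV[R]_n.+1 -> (sphere R n -> 'cV[R]_n.+1) -> 'cV[R]_n.+1.

Record affine_connection (nabla : connection) : Prop := AffineConnection {
  nabla_tangent : forall p v Y, tangent p v -> vector_field Y ->
    tangent p (nabla p v Y);
  nabla_linear : forall p (a : R) v w Y,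
    tangent p v -> tangent p w -> vector_field Y ->
    nabla p (a *: v + w) Y = a *: nabla p v Y + nabla p w Y;
  nabla_add : forall p v Y Z,
    tangent p v -> vector_field Y -> vector_field Z ->
    nabla p v (fun q => Y q + Z q) = nabla p v Y + nabla p v Z;
  nabla_leibniz : forall p v (f : sphere R n -> R^o) Y,
    tangent p v -> smooth_map f -> vector_field Y ->
    nabla p v (fun q => f q *: Y q) = dsphere f p v *: Y p + f p *: nabla p v Y;
  nabla_smooth : forall X Y, vector_field X -> vector_field Y ->
    smooth_map (fun p => nabla p (X p) Y)
}.

(* [X, Y] f = (nabla_X Y - nabla_Y X) f for every function f. *)
Definition torsion_free (nabla : connection) : Prop :=
  forall X Y (f : sphere R n -> R^o) p,
    vector_field X -> vector_field Y -> smooth_map f ->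
    dsphere (fun q => dsphere f q (Y q) : R^o) p (X p)
      - dsphere (fun q => dsphere f q (X q) : R^o) p (Y p)
    = dsphere f p (nabla p (X p) Y - nabla p (Y p) X).

(* Compatibility with the round metric, the restriction of [dot] to the tangent
   spaces. *)
Definition metric_connection (nabla : connection) : Prop :=
  forall Y Z p v, vector_field Y -> vector_field Z -> tangent p v ->
    dsphere (fun q => dot (Y q) (Z q) : R^o) p v
    = dot (nabla p v Y) (Z p) + dot (Y p) (nabla p v Z).

Definition levi_civita (nabla : connection) : Prop :=
  [/\ affine_connection nabla, torsion_free nabla & metric_connection nabla].

(* An endomorphism of the tangent space at p is represented by the matrix of its
   extension by 0 to the normal line; this realizes End(TS^n) as a smooth
   subbundle of the trivial bundle of matrices, and a tangent endomorphism has
   exactly one such matrix. *)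
Definition tangent_endo p (A : 'M[R]_n.+1) : Prop :=
  A *m val p = 0 /\ forall v, tangent p v -> tangent p (A *m v).

Definition almost_complex_structure (J : sphere R n -> 'M[R]_n.+1) : Prop :=
  [/\ smooth_map J,
      forall p, tangent_endo p (J p)
    & forall p v, tangent p v -> J p *m (J p *m v) = - v].

(* [A] is the endomorphism (nabla_v J)_p, i.e.
   A (Y p) = nabla_v (J Y) - J (nabla_v Y) for every vector field Y. *)
Definition is_covariant_derivative (nabla : connection)
    (J : sphere R n -> 'M[R]_n.+1) p v (A : 'M[R]_n.+1) : Prop :=
  tangent_endo p A /\
  forall Y, vector_field Y ->
    A *m Y p = nabla p v (fun q => J q *m Y q) - J p *m nabla p v Y.

End Sphere.

Lemma is_diff_big_sum (R : realType) (V W : normedModType R) (m : nat)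
    (f df : 'I_m -> V -> W) (x : V) :
  (forall i, is_diff x (f i) (df i)) ->
  is_diff x (fun y => \sum_(i < m) f i y) (fun y => \sum_(i < m) df i y).
Proof.
elim: m f df => [|m IH] f df fdf.
  have E (g : 'I_0 -> V -> W) : (fun y => \sum_(i < 0) g i y) = cst 0.
    by apply/funext => y; rewrite big_ord0.
  by rewrite !E; exact: is_diff_cst.
have E (g : 'I_m.+1 -> V -> W) : (fun y => \sum_(i < m.+1) g i y) =
    (fun y => \sum_(i < m) g (widen_ord (leqnSn m) i) y) + g ord_max.
  by apply/funext => y; rewrite big_ord_recr.
by rewrite !E; apply: is_diffD; exact: IH.
Qed.

Lemma is_diff_coord (R : realType) (m n : nat) (M : 'M[R]_(m.+1, n.+1)) i j :
  is_diff M (fun N : 'M[R]_(m.+1, n.+1) => N i j : R^o) (fun N => N i j : R^o).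
Proof.
pose g := fun N : 'M[R]_(m.+1, n.+1) => N i j : R^o.
have gl : linear g by move=> a u v; rewrite /g !mxE.
pose gM := GRing.isLinear.Build _ _ _ _ _ gl.
pose gL : {linear _ -> _} := HB.pack g gM.
have gc : continuous gL by move=> N; exact: coord_continuous.
apply: DiffDef; first exact: (linear_differentiable (f := gL) M gc).
exact: (diff_lin (f := gL) M gc).
Qed.

Lemma is_diff_dotxx (R : realType) (n : nat) (x : 'cV[R]_n.+1) :
  is_diff x (fun y => dot y y : R^o) (fun v => 2 * dot x v : R^o).
Proof.
have H i : is_diff x (fun y : 'cV[R]_n.+1 => y i 0 * y i 0 : R^o)
    (fun v => 2 * (x i 0 * v i 0) : R^o).
  have C := is_diff_coord x i 0; have := is_diffM C C; move=> h.
  apply: (is_diff_eq h); apply/funext => v.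
  by rewrite mulr_natl mulr2n.
apply: (is_diff_eq (is_diff_big_sum H)); apply/funext => v.
by rewrite /dot mulr_sumr.
Qed.

Section SphereFacts.
Variables (R : realType) (n : nat).
Implicit Types (p q : sphere R n) (v w : 'cV[R]_n.+1).

Let nrm (x : 'cV[R]_n.+1) := (Num.sqrt (dot x x))^-1 *: x.

Let nrm_id p : nrm (val p) = val p.
Proof. by rewrite /nrm (eqP (valP p)) sqrtr1 invr1 scale1r. Qed.

Let nrm_sphere (x : 'cV[R]_n.+1) : 0 < dot x x -> dot (nrm x) (nrm x) == 1.
Proof.
move=> x0; rewrite /dot; under eq_bigr do rewrite !mxE mulrACA -invfM -expr2.
rewrite -mulr_sumr -/(dot x x) sqr_sqrtr ?ltW// mulVf//.
by rewrite gt_eqF.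
Qed.

Let is_diff_nrm p v : tangent p v ->
  differentiable nrm (val p) /\ 'd nrm (val p) v = v.
Proof.
move=> pv.
pose N (x : 'cV[R]_n.+1) : R^o := (Num.sqrt (dot x x))^-1.
pose h (t : R) : R^o := (Num.sqrt t)^-1.
have dd := is_diff_dotxx (val p).
have dh : differentiable h (dot (val p) (val p)).
  rewrite (eqP (valP p)); apply: differentiableV; last first.
    by rewrite sqrtr1 oner_eq0.
  by apply/derivable1_diffP; apply: ex_derive; exact: is_derive1_sqrt.
have dN : differentiable N (val p).
  have d0 := @ex_diff _ _ _ _ _ _ _ dd.
  exact: (differentiable_comp d0 dh).
have dN0 : 'd N (val p) v = 0.
  have -> : N = h \o (fun y => dot y y : R^o) by [].
  have d0 := @ex_diff _ _ _ _ _ _ _ dd.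
  rewrite (diff_comp d0 dh)/=.
  have -> : 'd (fun y => dot y y : R^o) (val p) v = 0.
    by rewrite diff_val pv mulr0.
  by rewrite linear0.
have dc i : is_diff (val p)
    (fun x => (N x * x i 0 : R^o) *: (delta_mx i 0 : 'cV[R]_n.+1))
    (fun w => (N (val p) * w i 0 + val p i 0 * 'd N (val p) w)
              *: delta_mx i 0).
  have dNc := is_diffM (differentiableP dN) (is_diff_coord (val p) i 0).
  have dNcd := @ex_diff _ _ _ _ _ _ _ dNc.
  apply: DiffDef; first exact: (differentiableZl _ dNcd).
  by rewrite (diffZl _ dNcd); apply/funext => w; rewrite diff_val.
have nE (x : 'cV[R]_n.+1) (F : 'I_n.+1 -> R) :
    \sum_(i < n.+1) F i *: (delta_mx i 0 : 'cV[R]_n.+1) = \col_i F i.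
  apply/colP => j; rewrite summxE (bigD1 j)//= !mxE eqxx/= mulr1 big1 ?addr0//.
  by move=> i /negbTE ij; rewrite !mxE eq_sym ij/= mulr0.
have ds := is_diff_big_sum dc.
have -> : nrm = (fun y => \sum_(i < n.+1) (N y * y i 0 : R^o) *: delta_mx i 0).
  by apply/funext => y; rewrite nE//; apply/colP => i; rewrite !mxE.
split; first exact: ex_diff.
rewrite diff_val nE//; apply/colP => i; rewrite !mxE dN0 mulr0 addr0.
by rewrite /N (eqP (valP p)) sqrtr1 invr1 mul1r.
Qed.

Lemma dsphere_ext (W : normedModType R) (f : sphere R n -> W) p v
    (U : set 'cV[R]_n.+1) (F : 'cV[R]_n.+1 -> W) :
  tangent p v -> open U -> U (val p) -> differentiable F (val p) ->
  (forall q, U (val q) -> F (val q) = f q) ->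
  dsphere f p v = 'd F (val p) v.
Proof.
move=> pv Uo Up dF Ff; have [dn dnE] := is_diff_nrm pv.
have dF' : differentiable F (nrm (val p)) by rewrite nrm_id.
transitivity ('D_v (F \o nrm) (val p)).
  apply: near_eq_derive.
  have nc := differentiable_continuous dn.
  have nU : \forall x \near val p, U (nrm x).
    by apply: nc; rewrite nrm_id; exact: open_nbhs_nbhs.
  have dd := is_diff_dotxx (val p).
  have dpos : \forall x \near val p, 0 < dot x x.
    have /differentiable_continuous := @ex_diff _ _ _ _ _ _ _ dd.
    move=> /(_ [set t | 0 < t]); apply.
    by apply: lt_nbhsr; rewrite (eqP (valP p)).
  near=> x.
  have xs : dot (nrm x) (nrm x) == 1 by apply: nrm_sphere; near: x.
  have vE : val (insubd p (nrm x)) = nrm x by rewrite insubdK.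
  by rewrite /= -Ff vE//; near: x.
rewrite deriveE; last exact: differentiable_comp.
by rewrite diff_comp//= dnE nrm_id.
Unshelve. all: by end_near. Qed.

End SphereFacts.

(* Main.v *)
Require Import Defs.
From mathcomp Require Import all_boot all_order all_algebra.
From mathcomp Require Import all_classical all_reals all_analysis.
From mathcomp Require Import ring lra zify.
Set Implicit Arguments.
Unset Strict Implicit.
Unset Printing Implicit Defensive.
Import Order.TTheory GRing.Theory Num.Theory numFieldNormedType.Exports.
Local Open Scope classical_set_scope.
Local Open Scope ring_scope.

(** The idea is that the first Chern form of J, for a suitable connection, is
    a symplectic form, which the six-sphere cannot carry.

    Complete (TS^6, J) by the trivial plane bundle spanned by the unit normal
    n and by an extra direction, with the rotation that sends n to that
    direction; this turns J into a map [stab] from S^6 to the 8 x 8 matrices Q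
    with Q ^ 2 = -1. For every such map the 2-form
    omega(u, v) = tr(Q dQ(u) dQ(v)) is closed ([curv_closed]): its exterior
    derivative reduces to tr(dQ dQ dQ), which vanishes because dQ anticommutes
    with Q. Writing A_X for the covariant derivative of J along X, a block
    computation gives
      omega(X, Y) = tr(J A_X A_Y) - 2 <Y, J X> + 2 <X, J Y>
    ([trace_stab], [trace_stab_taming]), where the last two terms reflect
    the curvature of the round metric. When A_X and A_JX commute, the trace
    vanishes for Y = J X, since J anticommutes with both; hence
    omega(X, J X) = - 2 (|X| ^ 2 + |J X| ^ 2) < 0 and omega is nondegenerate
    ([curv_taming]). That the Levi-Civita connection is the tangential
    projection of the derivative in R^7, so that A_X is the tangential part of
    dJ(X), is [levi_civitaE].

    The contradiction is Stokes' theorem for omega ^ 3, in a form that needs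
    neither a primitive of omega nor integration. Let phi be the map [chart]
    from R^6 to S^6 which is an immersion inside a ball contained in the unit
    cube (centred at the origin) and constant outside that ball. On R^7 with
    coordinates (t, x), let a and b be the pullbacks of omega by
    (t, x) |-> phi(t x) and by (t, x) |-> phi(x). The 6-form a /\ b /\ b is
    closed, so that its dual vector field [flux] is divergence free
    ([divergence_flux]). Through the faces of the cube where t is constant its
    flux density is 0 at t = 0 and, up to a factor, omega ^ 3 in the chart at
    t = 1; through the other faces it is zero, because b vanishes there. By
    the divergence theorem on the cube ([divergence_free_face]), if the density
    of omega ^ 3 has a constant sign then it is zero at the centre. But it has
    no zero in the ball ([cube_density_neq0]), hence a constant sign there. *)

(** * Functions of class C^k *)

Section Differentials.
Variables (R : realType) (V W : normedModType R).
Implicit Types (f g : V -> W) (x v : V) (U : set V).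

(** Differentials are choices of linear maps, hence the detour through the
    first order expansion to see that they only depend on germs. *)
Lemma is_diff_near f g x : (\near x, f x = g x) -> differentiable f x ->
  is_diff x g ('d f x).
Proof.
move=> fg df; have fgx := nbhs_singleton fg.
have dfc := diff_continuous df.
have E : g \o shift x = cst (g x) + 'd f x +o_ 0 id.
  apply/eqaddoP => _/posnumP[e].
  have /eqaddoP /(_ e%:num (gt0 e)) := diff_locally df.
  move: fg; rewrite (near_shift 0 x) subr0 => fg.
  by apply: filterS2 fg => y /=; rewrite !fctE /= => ->; rewrite fgx.
have dE := diff_unique dfc E.
by apply: DiffDef; [apply/diff_locallyP; rewrite dE; split|exact: dE].
Qed.

Lemma diff_open_ext f g U : open U -> (forall x, U x -> f x = g x) ->
  forall x, U x -> differentiable f x -> is_diff x g ('d f x).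
Proof.
move=> Uo fg x Ux; apply: is_diff_near.
by apply: filterS (open_nbhs_nbhs (conj Uo Ux)) => y; exact: fg.
Qed.

Lemma Ck_ext k f g U : open U -> (forall x, U x -> f x = g x) ->
  Ck k U f -> Ck k U g.
Proof.
elim: k f g => [|k IH] f g Uo fg /=.
  move=> fc x Ux; have fxc := fc x Ux.
  suff : g @ x --> g x by [].
  rewrite -(fg x Ux); apply: cvg_trans fxc; apply: near_eq_cvg.
  by apply: filterS (open_nbhs_nbhs (conj Uo Ux)) => y /fg.
move=> [fd fC]; have E := diff_open_ext Uo fg.
split=> [x Ux|v]; first by have := E x Ux (fd x Ux) => ?; exact: ex_diff.
apply: (IH _ _ Uo _ (fC v)) => x Ux.
by have := E x Ux (fd x Ux) => ?; rewrite [in RHS]diff_val.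
Qed.

Lemma Ck_sub k f U U' : U' `<=` U -> Ck k U f -> Ck k U' f.
Proof.
move=> UU'; elim: k f => [|k IH] f /=; first by move=> fc x /UU'; exact: fc.
by move=> [fd fC]; split=> [x /UU'|v]; [exact: fd|exact: IH].
Qed.

(** Being of class C^k is, as encoded, a condition at each point separately;
    this is what makes it local. *)
Lemma Ck_cover k f U :
  (forall x, U x -> exists2 U', U' x & Ck k U' f) -> Ck k U f.
Proof.
elim: k f => [|k IH] f /= H.
  by move=> x /H[U' U'x c]; exact: c.
split=> [x /H[U' U'x [c _]]|v]; first exact: c.
by apply: IH => x /H[U' U'x [_ c]]; exists U'.
Qed.

Lemma CkS k f U : Ck k.+1 U f -> Ck k U f.
Proof.
elim: k f => [|k IH] f /= [fd fC].
  by move=> x Ux; apply: differentiable_continuous; exact: fd.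
by split=> // v; apply: IH; exact: fC.
Qed.

Lemma Ck_continuous k f U : Ck k U f -> forall x, U x -> {for x, continuous f}.
Proof. by elim: k => // k IH /CkS. Qed.

Lemma Ck_differentiable k f U :
  Ck k.+1 U f -> forall x, U x -> differentiable f x.
Proof. by case. Qed.

Lemma Ck_diff k f U v : Ck k.+1 U f -> Ck k U (fun x => 'd f x v).
Proof. by case=> _; exact. Qed.

Lemma Ck_cst k U (a : W) : Ck k U (cst a : V -> W).
Proof.
elim: k a => [|k IH] a /=; first by move=> x _; exact: cst_continuous.
split=> [x _|v]; first exact: differentiable_cst.
by under eq_fun do rewrite diff_cst; exact: IH.
Qed.

Lemma CkD k U f g : open U -> Ck k U f -> Ck k U g ->
  Ck k U (fun x => f x + g x).
Proof.
move=> Uo; elim: k f g => [|k IH] f g /=.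
  by move=> fc gc x Ux; apply: continuousD; [exact: fc|exact: gc].
move=> [fd fC] [gd gC]; split=> [x Ux|v].
  by apply: differentiableD; [exact: fd|exact: gd].
apply: (Ck_ext Uo _ (IH _ _ (fC v) (gC v))) => x Ux.
by have := diffD (fd x Ux) (gd x Ux) => /(congr1 (@^~ v)) /= <-.
Qed.

Lemma CkZl k U (h : V -> R^o) (a : W) : open U -> Ck k U h ->
  Ck k U (fun x => h x *: a).
Proof.
move=> Uo; elim: k h => [|k IH] h /=.
  by move=> hc x Ux; apply: continuousZr_tmp; exact: hc.
move=> [hd hC]; split=> [x Ux|v]; first exact: (differentiableZl _ (hd x Ux)).
apply: (Ck_ext Uo _ (IH _ (hC v))) => x Ux.
by rewrite (diffZl _ (hd x Ux)).
Qed.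

Lemma Ck_sum k U (m : nat) (F : 'I_m -> V -> W) : open U ->
  (forall i, Ck k U (F i)) -> Ck k U (fun x => \sum_(i < m) F i x).
Proof.
move=> Uo; elim: m F => [|m IH] F FC.
  by apply: (Ck_ext Uo _ (Ck_cst k U 0)) => x _; rewrite big_ord0.
apply: (Ck_ext Uo _ (CkD Uo (IH _ (fun i => FC (widen_ord (leqnSn m) i)))
  (FC ord_max))) => x _.
by rewrite big_ord_recr.
Qed.

End Differentials.

Section Scalar.
Variables (R : realType) (V : normedModType R).
Implicit Types (f g : V -> R^o) (U : set V).

Lemma CkM k U f g : open U -> Ck k U f -> Ck k U g ->
  Ck k U (fun x => f x * g x : R^o).
Proof.
move=> Uo; elim: k f g => [|k IH] f g.
  by move=> /= fc gc x Ux; apply: continuousM; [exact: fc|exact: gc].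
move=> fC gC; split=> [x Ux|v].
  by apply: differentiableM; apply: Ck_differentiable Ux; [exact: fC|exact: gC].
apply: (@Ck_ext _ _ _ k
    (fun x => f x * 'd g x v + g x * 'd f x v : R^o)) => // [x Ux|].
  have fd := Ck_differentiable fC Ux; have gd := Ck_differentiable gC Ux.
  exact: (esym (congr1 (@^~ v) (diffM fd gd))).
apply: (CkD Uo).
  exact: (IH _ _ (CkS fC) (Ck_diff v gC)).
exact: (IH _ _ (CkS gC) (Ck_diff v fC)).
Qed.

Lemma CkV k U f : open U -> (forall x, U x -> f x != 0) -> Ck k U f ->
  Ck k U (fun x => (f x)^-1 : R^o).
Proof.
move=> Uo f0; elim: k => [|k IH].
  move=> /= fc x Ux.
  by apply: (@continuousV _ _ f); [exact: f0|exact: fc].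
move=> fC; split=> [x Ux|v].
  by apply: differentiableV; [exact: Ck_differentiable fC _ Ux|exact: f0].
have IHf := IH (CkS fC).
pose df2 x : R^o := (f x)^-1 * (f x)^-1 * (-1 * 'd f x v).
have df2C : Ck k U df2.
  apply: (CkM Uo); first exact: (CkM Uo IHf IHf).
  exact: (CkM Uo (Ck_cst k U _) (Ck_diff v fC)).
apply: (Ck_ext Uo _ df2C) => x Ux; rewrite /df2 mulN1r mulrN -invfM -expr2
    -mulNr.
exact: (esym (congr1 (@^~ v) (diffV (Ck_differentiable fC Ux) (f0 _ Ux)))).
Qed.

End Scalar.

Section Matrices.
Variables (R : realType) (V : normedModType R) (a b : nat).
Implicit Types (f : V -> 'M[R]_(a.+1, b.+1)) (U : set V).

Lemma diff_entry f x v i j : differentiable f x ->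
  'd (fun y => f y i j : R^o) x v = ('d f x v) i j.
Proof.
move=> fd; have c := is_diff_coord (f x) i j.
have cd := @ex_diff _ _ _ _ _ _ _ c.
rewrite (congr1 (@^~ v) (diff_comp fd cd)) /=.
exact: (congr1 (@^~ ('d f x v)) (@diff_val _ _ _ _ _ _ _ c)).
Qed.

Lemma differentiable_entry f x i j : differentiable f x ->
  differentiable (fun y => f y i j : R^o) x.
Proof.
move=> fd; have c := is_diff_coord (f x) i j.
exact: (differentiable_comp fd (@ex_diff _ _ _ _ _ _ _ c)).
Qed.

Lemma differentiable_entries f x :
  (forall i j, differentiable (fun y => f y i j : R^o) x) -> differentiable f x.
Proof.
move=> fd.
have -> : f = (\sum_(i < a.+1) \sum_(j < b.+1)
    (fun y => f y i j *: (delta_mx i j : 'M[R]_(a.+1, b.+1)))).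
  apply/funext => y; rewrite fct_sumE [LHS]matrix_sum_delta.
  by apply: eq_bigr => i _; rewrite fct_sumE.
apply: differentiable_sum => i; apply: differentiable_sum => j.
exact: differentiableZl.
Qed.

Lemma Ck_entry k U f : open U -> Ck k U f ->
  forall i j, Ck k U (fun x => f x i j : R^o).
Proof.
move=> Uo; elim: k f => [|k IH] f.
  move=> /= fc i j x Ux.
  exact: (@continuous_comp _ _ R^o f (fun N => N i j) x (fc x Ux)
            (@coord_continuous _ _ _ i j (f x))).
move=> fC i j; have fd := Ck_differentiable fC.
split=> [x Ux|v]; first exact: (differentiable_entry i j (fd x Ux)).
apply: (Ck_ext Uo _ (IH _ (Ck_diff v fC) i j)) => x Ux.
by rewrite (diff_entry _ _ _ (fd x Ux)).
Qed.

Lemma Ck_mx k U f : open U -> (forall i j, Ck k U (fun x => f x i j : R^o)) ->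
  Ck k U f.
Proof.
move=> Uo fC; pose F x := \sum_(i < a.+1) \sum_(j < b.+1)
    f x i j *: (delta_mx i j : 'M[R]_(a.+1, b.+1)).
have FC : Ck k U F.
  by apply: (Ck_sum Uo) => i; apply: (Ck_sum Uo) => j; exact:
      (CkZl _ Uo (fC i j)).
by apply: (Ck_ext Uo _ FC) => y _; rewrite /F -matrix_sum_delta.
Qed.

End Matrices.

Section Composition.
Variables (R : realType) (V : normedModType R) (m : nat).

Lemma cV_sum_delta (w : 'cV[R]_m.+1) :
  w = \sum_(i < m.+1) w i 0 *: (delta_mx i 0 : 'cV[R]_m.+1).
Proof.
rewrite [LHS]matrix_sum_delta; apply: eq_bigr => i _.
by rewrite big_ord_recl big_ord0 addr0.
Qed.

(** In the chain rule the direction in which f is differentiated moves with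
    the point; expanding it in the standard basis reduces the differential of
    the composite to sums of products of functions of class C^(k-1). *)
Lemma Ck_comp_scalar k (U : set V) (U' : set 'cV[R]_m.+1)
    (g : V -> 'cV[R]_m.+1) (f : 'cV[R]_m.+1 -> R^o) :
  open U -> (forall x, U x -> U' (g x)) -> Ck k U g -> Ck k U' f ->
  Ck k U (fun x => f (g x)).
Proof.
move=> Uo gU; elim: k g f gU => [|k IH] g f gU.
  move=> /= gc fc x Ux.
  exact: (continuous_comp (gc x Ux) (fc _ (gU x Ux))).
move=> gC fC.
have gd := Ck_differentiable gC; have fd := Ck_differentiable fC.
split=> [x Ux|v]; first exact: (differentiable_comp (gd x Ux) (fd _ (gU x Ux))).
pose dF x : R^o := \sum_(i < m.+1) ('d g x v) i 0 * 'd f (g x) (delta_mx i 0).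
have dFC : Ck k U dF.
  apply: (Ck_sum Uo) => i; apply: (CkM Uo).
    exact: (Ck_entry Uo (Ck_diff v gC)).
  exact: (IH g (fun y => 'd f y (delta_mx i 0)) gU (CkS gC) (Ck_diff _ fC)).
apply: (Ck_ext Uo _ dFC) => x Ux.
have := congr1 (@^~ v) (diff_comp (gd x Ux) (fd _ (gU x Ux))) => /= ->.
rewrite /dF [in RHS](cV_sum_delta ('d g x v)) linear_sum.
by apply: eq_bigr => i _; rewrite linearZ.
Qed.

Lemma Ck_comp a b k (U : set V) (U' : set 'cV[R]_m.+1)
    (g : V -> 'cV[R]_m.+1) (f : 'cV[R]_m.+1 -> 'M[R]_(a.+1, b.+1)) :
  open U -> open U' -> (forall x, U x -> U' (g x)) ->
  Ck k U g -> Ck k U' f -> Ck k U (fun x => f (g x)).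
Proof.
move=> Uo U'o gU gC fC; apply: (Ck_mx Uo) => i j.
exact: (Ck_comp_scalar Uo gU gC (Ck_entry U'o fC i j)).
Qed.

Lemma Ck_mulmx a b c k (U : set V) (A : V -> 'M[R]_(a.+1, b.+1))
    (B : V -> 'M[R]_(b.+1, c.+1)) : open U ->
  Ck k U A -> Ck k U B -> Ck k U (fun x => A x *m B x).
Proof.
move=> Uo AC BC; apply: (Ck_mx Uo) => i j.
pose F x : R^o := \sum_(l < b.+1) A x i l * B x l j.
have FC : Ck k U F.
  apply: (Ck_sum Uo) => l.
  exact: (CkM Uo (Ck_entry Uo AC i l) (Ck_entry Uo BC l j)).
by apply: (Ck_ext Uo _ FC) => x _; rewrite mxE.
Qed.

Lemma diff_mulmx a b c (x v : V) (A : V -> 'M[R]_(a.+1, b.+1))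
    (B : V -> 'M[R]_(b.+1, c.+1)) :
  differentiable A x -> differentiable B x ->
  differentiable (fun x => A x *m B x) x /\
  'd (fun x => A x *m B x) x v = 'd A x v *m B x + A x *m 'd B x v.
Proof.
move=> Ad Bd; have E i j : (fun y => (A y *m B y) i j : R^o) =
    (\sum_(l < b.+1) (fun y => A y i l * B y l j : R^o)).
  by apply/funext => y; rewrite mxE fct_sumE.
have dAB i l j : is_diff x (fun y => A y i l * B y l j : R^o)
    (fun w => A x i l * ('d B x w) l j + B x l j * ('d A x w) i l).
  have dA := differentiableP (differentiable_entry i l Ad).
  have dB := differentiableP (differentiable_entry l j Bd).
  apply: is_diff_eq (is_diffM dA dB) _.
  by apply/funext => w; rewrite !fctE !diff_entry.
have d : differentiable (fun x => A x *m B x) x.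
  apply: differentiable_entries => i j; rewrite E.
  by apply: differentiable_sum => l; have ? := dAB i l j; exact: ex_diff.
split=> //; apply/matrixP => i j; rewrite -diff_entry//.
have := is_diff_big_sum (fun l => dAB i l j) => ds.
have -> : (fun y => (A y *m B y) i j : R^o) =
    (fun y => \sum_(l < b.+1) (A y i l * B y l j : R^o)).
  by apply/funext => y; rewrite mxE.
rewrite diff_val !mxE -big_split; apply: eq_bigr => l _ /=.
by rewrite addrC; congr (_ + _); rewrite mulrC.
Qed.

End Composition.

(** * Symmetry of second derivatives *)

Section Schwarz.
Variables (R : realType) (V : normedModType R).
Implicit Types (f : V -> R^o) (x y u v : V).

Lemma is_derive_line f y u (s : R) : differentiable f (y + s *: u) ->
  is_derive s 1 (fun t : R => f (y + t *: u)) ('d f (y + s *: u) u).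
Proof.
move=> fd; pose l (t : R^o) := y + t *: u.
have ld : is_diff (s : R^o) l (fun t => t *: u).
  have := is_diffD (is_diff_cst y (s : R^o)) (is_diff_scalel (s : R^o) u).
  by move/is_diff_eq; apply; apply/funext => t; rewrite fctE add0r.
have ldd := @ex_diff _ _ _ _ _ _ _ ld.
have fld := differentiable_comp ldd fd.
apply: DeriveDef; first exact: (diff_derivable fld).
apply: (etrans (deriveE (1 : R^o) fld)).
apply: (etrans (congr1 (@^~ 1) (diff_comp ldd fd))) => /=.
by rewrite (congr1 (@^~ 1) (@diff_val _ _ _ _ _ _ _ ld)) scale1r.
Qed.

Lemma MVT_line f y u (h : R) : 0 <= h -> (forall z, differentiable f z) ->
  exists2 c, 0 <= c <= h & f (y + h *: u) - f y = h * 'd f (y + c *: u) u.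
Proof.
move=> h0 fd.
have drv (s : R) := is_derive_line (fd (y + s *: u)).
have H1 (s : R) : s \in `]0, h[%R ->
  is_derive s 1 (fun t => f (y + t *: u)) ('d f (y + s *: u) u) by move=> _.
have H2 : {within `[0, h], continuous (fun t : R => f (y + t *: u))}.
  apply: continuous_subspaceT => s; apply: differentiable_continuous.
  by apply/derivable1_diffP; have := drv s => -[].
have [c + E] := MVT_segment h0 H1 H2.
rewrite in_itv /= => ch; exists c => //.
by move: E; rewrite scale0r addr0 subr0 mulrC.
Qed.

(** Two applications of the mean value theorem, first to the increment of f
    along v as a function along u. *)
Lemma double_difference f x u v (h : R) : 0 <= h ->
  (forall z, differentiable f z) ->
  (forall z, differentiable (fun y => 'd f y u : R^o) z) ->
  exists s t, [/\ 0 <= s <= h, 0 <= t <= h &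
    f (x + h *: u + h *: v) - f (x + h *: u) - (f (x + h *: v) - f x) =
    h ^+ 2 * 'd (fun y => 'd f y u : R^o) (x + s *: u + t *: v) v].
Proof.
move=> h0 fd fud.
pose g y : R^o := f (y + h *: v) - f y.
have gd z : is_diff z g (fun w => 'd f (z + h *: v) w - 'd f z w).
  have sd : is_diff z (fun y => y + h *: v) id.
    have := is_diffD (is_diff_id z) (is_diff_cst (h *: v) z).
    by move/is_diff_eq; apply; apply/funext => t; rewrite fctE addr0.
  exact: (is_diffB (is_diff_comp sd (differentiableP (fd (z + h *: v))))
    (differentiableP (fd z))).
have gdd z : differentiable g z by have := gd z => ?; exact: ex_diff.
have [s sh Eg] := MVT_line x u h0 gdd.
have [t th Ef] := MVT_line (x + s *: u) v h0 fud.
exists s, t; split => //.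
rewrite expr2 -mulrA -Ef.
have -> : 'd f (x + s *: u + h *: v) u - 'd f (x + s *: u) u
    = 'd g (x + s *: u) u.
  by have := gd (x + s *: u) => ?; rewrite [in RHS]diff_val.
by rewrite -Eg.
Qed.

(** Both iterated derivatives are limits of the same second difference, since
    that difference is symmetric in u and v. *)
Lemma schwarz f x u v : Ck 2 setT f ->
  'd (fun y => 'd f y u : R^o) x v = 'd (fun y => 'd f y v : R^o) x u.
Proof.
move=> fC; have fd z : differentiable f z := Ck_differentiable fC I.
have fwd w z : differentiable (fun y => 'd f y w : R^o) z :=
  Ck_differentiable (Ck_diff w fC) I.
have fwc w w' : continuous (fun z => 'd (fun y => 'd f y w : R^o) z w' : R^o).
  by move=> z; apply: (Ck_continuous (Ck_diff w' (Ck_diff w fC))).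
apply/eqP; rewrite -subr_eq0 -normr_le0; apply/ler_addgt0Pr => e e0; rewrite
    add0r.
have e20 : 0 < e / 2 by rewrite divr_gt0.
have near_uv w w' : \forall z \near x,
    `|'d (fun y => 'd f y w : R^o) x w' - 'd (fun y => 'd f y w : R^o) z w'| < e
        / 2.
  by have /cvgrPdist_lt /(_ _ e20) := fwc w w' x.
have nb := filterI (near_uv u v) (near_uv v u).
have [d /= d0 dH] := (nbhs_ballP x _).1 (nb _).
(* small enough for the parallelogram spanned by h u and h v to lie in the
   ball of radius d around x *)
pose h := d / 2 / (1 + `|u| + `|v|).
have k0 : 0 < 1 + `|u| + `|v| by rewrite -addrA ltr_pwDl// addr_ge0.
have h0 : 0 < h by rewrite !divr_gt0.
have inb s t : 0 <= s <= h -> 0 <= t <= h -> ball x d (x + s *: u + t *: v).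
  move=> /andP[s0 sh] /andP[t0 th]; rewrite -ball_normE /= -addrA opprD addNKr
      normrN.
  apply: (le_lt_trans (ler_normD _ _)); rewrite !normrZ !ger0_norm//.
  apply: (@le_lt_trans _ _ (h * (1 + `|u| + `|v|))).
    rewrite -addrA mulrDr mulr1 mulrDr; apply: ler_wpDl; first exact: ltW.
    by apply: lerD; apply: ler_wpM2r.
  by rewrite /h divfK ?gt_eqF// ltr_pdivrMr// mulr_natr mulr2n ltrDl.
have [s [t [sh th E1]]] := double_difference x v (ltW h0) fd (fwd u).
have [t' [s' [th' sh' E2]]] := double_difference x u (ltW h0) fd (fwd v).
have E : 'd (fun y => 'd f y u : R^o) (x + s *: u + t *: v) v =
         'd (fun y => 'd f y v : R^o) (x + s' *: u + t' *: v) u.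
  apply: (mulfI (x := h ^+ 2)); first by rewrite expf_neq0// gt_eqF.
  rewrite -E1 (addrAC x (s' *: u)) -E2 (addrAC x (h *: v)).
  set p := f _; set q := f _; set r := f _; set w := f _; clearbody p q r w.
  by rewrite /GRing.regular in p q r w *; ring.
have [/= + _] := dH _ (inb _ _ sh th); have [/= _] := dH _ (inb _ _ sh' th').
rewrite E => H1 H2; rewrite [leRHS]splitr.
set A := 'd _ _ _ in H1 H2 *; set B := ('d _ (x + _ + _)) _ in H1 H2.
rewrite -[X in `|X - _|](subrK B) -addrA.
by apply: (le_trans (ler_normD _ _)); rewrite lerD// ltW// distrC.
Qed.

End Schwarz.

(** * A divergence theorem on the cube *)

Section UniformContinuity.
Variables (R : realType) (m : nat).

Definition unit_box : set 'cV[R]_m.+1 := [set z | forall i, 0 <= z i 0 <= 1].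

Lemma unit_box_compact : compact unit_box.
Proof.
have -> : unit_box =
    trmx @` [set v : 'rV[R]_m.+1 | forall i, `[(0 : R), 1]%classic (v ord0 i)].
  apply/seteqP; split => [z zb|_ [v vb <-] i].
    exists z^T; last by rewrite trmxK.
    by move=> i; rewrite /= in_itv /= mxE; exact: zb.
  by have := vb i; rewrite /= in_itv /= mxE.
apply: continuous_compact; last first.
  by apply: (@rV_compact _ _ (fun=> `[(0 : R), 1]%classic)) => i; exact:
      segment_compact.
apply: continuous_subspaceT => v; apply: differentiable_continuous.
apply: differentiable_entries => i j.
have -> : (fun y : 'rV[R]_m.+1 => y^T i j : R^o) = (fun y => y j i).
  by apply/funext => y; rewrite mxE.
by have c := is_diff_coord v j i; exact: ex_diff.
Qed.

Lemma unif_continuous_along (D : 'cV[R]_m.+1 -> R^o) (e : 'cV[R]_m.+1) (eta : R)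
    :
  continuous D -> 0 < eta ->
  exists2 d : R, 0 < d & forall z t, unit_box z -> `|t| < d ->
    `|D (z + t *: e) - D z| < eta.
Proof.
move=> Dc eta0; have := unit_box_compact.
move=> /compact_near_coveringP => /(_ R (nbhs (0 : R))
  (fun t z => `|D (z + t *: e) - D z| < eta) _).
have H x : unit_box x -> \forall x' \near x & i \near nbhs (0 : R),
    `|D (x' + i *: e) - D x'| < eta.
  move=> _.
  have eta2 : 0 < eta / 2 by rewrite divr_gt0.
  have /cvgrPdist_lt /(_ _ eta2) nx := Dc x.
  have [d /= d0 dH] := (nbhs_ballP x _).1 nx.
  have e1 : 0 < 1 + `|e| by rewrite ltr_pwDl.
  exists (ball x (d / 2), ball (0 : R) (d / 2 / (1 + `|e|))).
    by split; apply: nbhsx_ballx; rewrite !divr_gt0.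
  move=> [z t] [/=]; rewrite -!ball_normE /= sub0r normrN => xz td.
  have xzd : ball x d z by rewrite -ball_normE /=; lra.
  have xzt : ball x d (z + t *: e).
    rewrite -ball_normE /= opprD addrA [ltRHS]splitr.
    apply: (le_lt_trans (ler_normB _ _)); apply: ltrD => //.
    rewrite normrZ; move: td; rewrite ltr_pdivlMr//; apply: le_lt_trans.
    by rewrite ler_wpM2l// lerDr.
  have := dH _ xzd; have := dH _ xzt; move=> /= H1 H2.
  rewrite -[D (z + _)](subrK (D x)) -addrA [ltRHS]splitr.
  by apply: (le_lt_trans (ler_normD _ _)); apply: ltrD => //; rewrite distrC.
move=> /(_ H) /nbhs_ballP[d /= d0 dH]; exists d => // z t zb td.
by apply: dH zb; rewrite -ball_normE /= sub0r normrN.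
Qed.

End UniformContinuity.

Section Grid.
Variables (R : realType) (m n : nat).
Implicit Types (k : {ffun 'I_m.+1 -> 'I_n.+1}) (i : 'I_m.+1).
Local Notation h := (n.+1%:R^-1 : R).
Local Notation e i := (delta_mx i 0 : 'cV[R]_m.+1).

Local Notation grid := {ffun 'I_m.+1 -> 'I_n.+1}.

Definition node k : 'cV[R]_m.+1 := \col_i ((k i)%:R * h).

(** The cyclic shift is a bijection of the grid, so that reindexing by it
    telescopes a sum of forward differences; it fails to be the forward step
    only on the last layer. *)
Definition cyclic_shift i k : {ffun 'I_m.+1 -> 'I_n.+1} :=
  [ffun j => if j == i then ordS (k j) else k j].

Lemma cyclic_shift_inj i : injective (cyclic_shift i).
Proof.
move=> k k' /ffunP E; apply/ffunP => j; have := E j; rewrite !ffunE.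
by case: eqP => // _ /(can_inj (@ordSK _)).
Qed.

Lemma node_box k : unit_box (node k).
Proof.
move=> i; rewrite mxE divr_ge0 //= ler_pdivrMr ?ltr0n// mul1r ler_nat.
exact: ltnW.
Qed.

Lemma node_top i k : k i = ord_max -> (node k + h *: e i) i 0 = 1.
Proof.
move=> ki; rewrite !mxE !eqxx ki /= mulr1 -[X in _ + X]mul1r -mulrDl natr1.
by rewrite divff// pnatr_eq0.
Qed.

Lemma node_shift_top i k : k i = ord_max -> node (cyclic_shift i k) i 0 = 0.
Proof. by move=> ki; rewrite mxE ffunE eqxx ki /= modnn mul0r. Qed.

Lemma telescope (W : 'cV[R]_m.+1 -> R^o) i :
  \sum_(k : grid) (W (node k + h *: e i) - W (node k)) =
  \sum_(k : grid | k i == ord_max)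
    (W (node k + h *: e i) - W (node (cyclic_shift i k))).
Proof.
rewrite sumrB [X in _ - X](reindex_inj (@cyclic_shift_inj i)) -sumrB.
rewrite [LHS](bigID (fun k => k i == ord_max)) /= [X in _ + X]big1 ?addr0// => k
    ki.
apply/eqP; rewrite subr_eq0; apply/eqP; congr W; apply/colP => j.
rewrite !mxE !ffunE andbT; case: (eqVneq j i) => [->|_]; last by rewrite mulr0
    addr0.
have : (k i < n)%N.
  by rewrite ltn_neqAle -ltnS ltn_ord andbT; apply: contra ki => /eqP ?;
      apply/eqP/val_inj.
by move=> kin; rewrite /= modn_small// mulr1 -[(k i).+1%:R]natr1 mulrDl mul1r.
Qed.

End Grid.

Section DivergenceFree.
Variables (R : realType) (m : nat).
Local Notation e i := (delta_mx i 0 : 'cV[R]_m.+1).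

(** The centre of the face of the unit cube where the coordinate of index 0
    equals 1. *)
Definition face_center : 'cV[R]_m.+1 := \col_i (if i == ord0 then 1 else 2^-1).

Lemma card_interval (n a L : nat) : (a + L <= n.+1)%N ->
  (L <= #|[pred j : 'I_n.+1 | (a <= j < a + L)%N]|)%N.
Proof.
move=> aL; pose f (l : 'I_L) : 'I_n.+1 := inord (a + l).
have fE l : f l = (a + l)%N :> nat.
  by rewrite /f inordK// (leq_trans _ aL)// ltn_add2l.
have finj : injective f.
  by move=> l l' /(congr1 val) /=; rewrite !fE => /addnI ?; exact: val_inj.
rewrite -[leqLHS]card_ord -(card_imset predT finj).
apply: subset_leq_card; apply/fintype.subsetP => _ /imsetP[l _ ->].
by rewrite inE fE leq_addr ltn_add2l ltn_ord.
Qed.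

(** For a grid of mesh 1 / (2 M L), the nodes one step below the face with
    coordinate 0 equal to 1 which project to a point of that face at distance
    less than 1 / (2 M) from its centre, in the sup norm. *)
Definition middle_nodes (n M L : nat) (i : 'I_m.+1) : pred 'I_n.+1 :=
  [pred j | if i == ord0 then j == ord_max else (M * L <= j < M * L + L)%N].

Lemma card_middle_nodes (n M L : nat) : n.+1 = (2 * M * L)%N -> (0 < M)%N ->
  (L ^ m <= #|family (@middle_nodes n M L)|)%N.
Proof.
move=> nE M0; rewrite card_family.
have -> : foldr muln 1%N [seq #|@middle_nodes n M L x| | x : 'I_m.+1] =
    (\prod_(i < m.+1) #|@middle_nodes n M L i|)%N.
  by rewrite foldrE big_map big_enum.
rewrite big_ord_recl.
have -> : #|@middle_nodes n M L ord0| = 1%N.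
  by rewrite -(card1 (@ord_max n)); apply: eq_card => j; rewrite !inE.
rewrite mul1n -[m in leqLHS]card_ord -prod_nat_const.
apply: leq_prod => i _; apply: leq_trans (@card_interval n (M * L) L _) _.
  by rewrite nE; nia.
by apply: subset_leq_card; apply/fintype.subsetP => j; rewrite !inE.
Qed.

(** The divergence theorem without integrals. On the grid of mesh h, the sum
    over all nodes and directions of the forward differences of W telescopes
    to its values on the boundary, that is on the face where z_0 = 1. As the
    divergence vanishes, each node contributes o(h) uniformly, hence the sum is
    o(h ^ -m); but if W_0 were positive at the centre of that face, it would
    exceed a fixed multiple of h ^ -m. *)
Lemma divergence_free_face (W : 'I_m.+1 -> 'cV[R]_m.+1 -> R^o) :
  (forall i, Ck 1 setT (W i)) ->
  (forall z, \sum_i 'd (W i) z (e i) = 0) ->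
  (forall (i : 'I_m.+1) (z : 'cV[R]_m.+1), i != ord0 -> z i 0 = 0 \/ z i 0 = 1
      -> W i z = 0) ->
  (forall z : 'cV[R]_m.+1, z ord0 0 = 0 -> W ord0 z = 0) ->
  (forall z : 'cV[R]_m.+1, z ord0 0 = 1 -> 0 <= W ord0 z) ->
  W ord0 face_center = 0.
Proof.
move=> WC divW Wside W0 W1; apply/eqP/negPn/negP => Wne.
have : 0 < W ord0 face_center.
  by rewrite lt_def Wne W1// mxE eqxx.
set c := W ord0 _ => c0; have c20 : 0 < c / 2 by rewrite divr_gt0.
have Wd i z : differentiable (W i) z := Ck_differentiable (WC i) I.
have [d d0 dH] : exists2 d, 0 < d & forall z, ball face_center d z -> c / 2 <= W
    ord0 z.
  have /cvgrPdist_lt /(_ _ c20) := differentiable_continuous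
      (Wd ord0 face_center).
  move=> /nbhs_ballP[d /= d0 dH]; exists d => // z /dH /=; rewrite -/c => cz.
  have := ler_norm (c - W ord0 z); lra.
have [M M0 Md] : exists2 M : nat, (0 < M)%N & M%:R^-1 < d.
  exists (Num.truncn d^-1).+1 => //.
  by rewrite invf_plt ?posrE ?ltr0n// truncnS_gt.
pose K : R := (2 * M)%:R ^+ m * m.+1%:R.
have K0 : 0 < K by rewrite mulr_gt0 ?exprn_gt0 ?ltr0n ?muln_gt0.
(* K eta = c / 4 is less than the contribution c / 2 of the nodes close to
   the centre, both counted in units of L ^ m *)
pose eta := c / 4 / K.
have eta0 : 0 < eta by rewrite !divr_gt0.
have [r r0 rH] : exists2 r : R, 0 < r & forall i z t, unit_box z -> `|t| < r ->
    `|'d (W i) (z + t *: e i) (e i) - 'd (W i) z (e i)| < eta.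
  have U i := unif_continuous_along (e i)
    (fun z => Ck_continuous (Ck_diff (e i) (WC i)) (I : setT z)) eta0.
  pose r i := projT1 (cid2 (U i)).
  have rP i : 0 < r i by rewrite /r; case: cid2.
  exists (\big[Order.min/1]_i r i).
    by elim/big_ind : _ => // x y x0 y0; rewrite lt_min x0.
  move=> i z t zb /bigmin_gtP[_ /(_ i isT)].
  by rewrite /r; case: cid2 => /= s _ H; exact: H.
pose L := (Num.truncn r^-1).+1.
have Lr : L%:R^-1 < r by rewrite invf_plt ?posrE ?ltr0n// truncnS_gt.
pose n := (2 * M * L).-1.
have nE : n.+1 = (2 * M * L)%N by rewrite prednK// !muln_gt0 M0.
pose h : R := n.+1%:R^-1.
have h0 : 0 < h by rewrite invr_gt0 ltr0n.
have hr : h < r.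
  apply: le_lt_trans Lr; rewrite lef_pV2 ?posrE ?ltr0n// ler_nat nE.
  by rewrite leq_pmull// muln_gt0.
pose S := \sum_i \sum_(k : {ffun 'I_m.+1 -> 'I_n.+1})
  (W i (node R k + h *: e i) - W i (node R k)).
have Su : S <= (n.+1 ^ m.+1)%:R * (m.+1%:R * (h * eta)).
  rewrite /S exchange_big /=.
  apply: (@le_trans _ _ (\sum_(k : {ffun 'I_m.+1 -> 'I_n.+1}) m.+1%:R *
      (h * eta))).
    apply: ler_sum => k _.
    apply: (@le_trans _ _ (\sum_i (W i (node R k + h *: e i) - W i (node R k)
        - h * 'd (W i) (node R k) (e i)))).
      by rewrite [leRHS]sumrB -mulr_sumr divW mulr0 subr0.
    apply: (@le_trans _ _ (\sum_(i < m.+1) h * eta)); last first.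
      by rewrite sumr_const card_ord mulr_natl.
    apply: ler_sum => i _.
    have [t /andP[t0 th] ->] := MVT_line (node R k) (e i) (ltW h0) (Wd i).
    rewrite -mulrBr ler_pM2l//; apply: ltW; apply: le_lt_trans (ler_norm _) _.
    apply: rH; first exact: node_box.
    by rewrite ger0_norm//; exact: le_lt_trans hr.
  by rewrite sumr_const -[leLHS]mulr_natl card_ffun !card_ord lexx.
have Sl : (L ^ m)%:R * (c / 2) <= S.
  rewrite /S big_ord_recl [X in _ + X]big1 => [|i _]; last first.
    rewrite telescope big1// => k /eqP ki; rewrite !Wside ?subrr//.
      by left; exact: node_shift_top.
    by right; exact: node_top.
  rewrite addr0 telescope.
  apply: (@le_trans _ _ (\sum_(k : {ffun 'I_m.+1 -> 'I_n.+1} | k \in family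
      (@middle_nodes n M L)) c / 2)).
    rewrite sumr_const -[leRHS]mulr_natl ler_pM2r// ler_nat.
    exact: card_middle_nodes.
  have kmax (k : {ffun 'I_m.+1 -> 'I_n.+1}) :
      k \in family (@middle_nodes n M L) -> k ord0 == ord_max.
    by move=> /familyP /(_ ord0); rewrite inE eqxx.
  rewrite big_mkcond [leRHS]big_mkcond /=; apply: ler_sum => k _.
  case: ifP => kF.
    have k0 := eqP (kmax _ kF).
    rewrite k0 eqxx (W0 _ (node_shift_top R k0)) subr0.
    apply: dH; rewrite -ball_normE /=.
    apply: (le_lt_trans _ Md); rewrite /Num.norm /= mx_normrE.
    apply: bigmax_le; first by rewrite invr_ge0 ler0n.
    move=> [i j] _ /=; rewrite ord1 !mxE.
    case: (eqVneq i ord0) => [->|i0].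
      have := node_top R k0; rewrite !mxE => ->.
      by rewrite subrr normr0 invr_ge0 ler0n.
    rewrite /= mulr0 addr0.
    have := familyP kF i; rewrite inE (negbTE i0) => /andP[kl ku].
    have nR : n.+1%:R = 2 * M%:R * L%:R :> R by rewrite nE !natrM.
    have [l kE] : exists l, k i = (M * L + l)%N :> nat.
      by exists (k i - M * L)%N; rewrite subnKC.
    rewrite kE nR natrD natrM.
    have M0' : 0 < M%:R :> R by rewrite ltr0n.
    have L0' : 0 < L%:R :> R by rewrite ltr0n.
    have -> : 2^-1 - (M%:R * L%:R + l%:R) / (2 * M%:R * L%:R) =
      - (l%:R / L%:R) / 2 * M%:R^-1 :> R by field; rewrite !gt_eqF.
    rewrite normrM [X in _ * X]gtr0_norm ?invr_gt0// ler_piMl ?invr_ge0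
        ?ler0n//.
    rewrite mulNr normrN ger0_norm ?divr_ge0//.
    have : l%:R / L%:R <= 1 :> R.
      by rewrite ler_pdivrMr// mul1r ler_nat ltnW// -(ltn_add2l (M * L)) -kE.
    by lra.
  case: ifP => // k0.
  move/eqP: k0 => k0.
  by rewrite (W0 _ (node_shift_top R k0)) subr0 W1//; exact: node_top.
have := le_trans Sl Su; apply/negP; rewrite -ltNge.
have -> : (n.+1 ^ m.+1)%:R * (m.+1%:R * (h * eta)) = (L ^ m)%:R * (c / 4) :> R.
  have NE : n.+1%:R = (2 * M)%:R * L%:R :> R by rewrite nE natrM.
  have N0 : n.+1%:R != 0 :> R by rewrite pnatr_eq0.
  have P0 : (2 * M)%:R ^+ m != 0 :> R.
    by rewrite expf_neq0// pnatr_eq0 -lt0n muln_gt0.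
  have m0 : m.+1%:R != 0 :> R by rewrite pnatr_eq0.
  have -> : (n.+1 ^ m.+1)%:R = n.+1%:R * ((2 * M)%:R ^+ m * L%:R ^+ m) :> R.
    by rewrite natrX exprS -exprMn -NE.
  rewrite natrX /eta /h /K; set N := n.+1%:R in N0 *; set P := _ ^+ m in P0 *.
  by field; rewrite !nat1r P0 m0 N0.
rewrite ltr_pM2l ?ltr0n ?expn_gt0//; lra.
Qed.

End DivergenceFree.

(** * Four-forms, six-forms and Pfaffians *)

Section Pfaffian.
Variables (K : comRingType) (T : Type).
Implicit Types (a b : T -> T -> K) (q : T -> T -> T -> T -> K).

(** Half of the 4-form b /\ b. *)
Definition pf4 b i1 i2 i3 i4 : K :=
  b i1 i2 * b i3 i4 - b i1 i3 * b i2 i4 + b i1 i4 * b i2 i3.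

(** The wedge product of a 2-form and a 4-form, evaluated on six vectors;
    wedge24 b (pf4 b) is three times the Pfaffian of b. *)
Definition wedge24 a q i1 i2 i3 i4 i5 i6 : K :=
  a i1 i2 * q i3 i4 i5 i6 - a i1 i3 * q i2 i4 i5 i6 + a i1 i4 * q i2 i3 i5 i6
  - a i1 i5 * q i2 i3 i4 i6 + a i1 i6 * q i2 i3 i4 i5 + a i2 i3 * q i1 i4 i5 i6
  - a i2 i4 * q i1 i3 i5 i6 + a i2 i5 * q i1 i3 i4 i6 - a i2 i6 * q i1 i3 i4 i5
  + a i3 i4 * q i1 i2 i5 i6 - a i3 i5 * q i1 i2 i4 i6 + a i3 i6 * q i1 i2 i4 i5
  + a i4 i5 * q i1 i2 i3 i6 - a i4 i6 * q i1 i2 i3 i5 + a i5 i6 * q i1 i2 i3 i4.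

(** The part of d(a /\ q) in which a is differentiated is da /\ q, which is
    zero. *)
Lemma wedge24_closedl (da : T -> T -> T -> K) q j0 j1 j2 j3 j4 j5 j6 :
  (forall i j k, da i j k - da j i k + da k i j = 0) ->
  wedge24 (da j0) q j1 j2 j3 j4 j5 j6 - wedge24 (da j1) q j0 j2 j3 j4 j5 j6
  + wedge24 (da j2) q j0 j1 j3 j4 j5 j6 - wedge24 (da j3) q j0 j1 j2 j4 j5 j6
  + wedge24 (da j4) q j0 j1 j2 j3 j5 j6 - wedge24 (da j5) q j0 j1 j2 j3 j4 j6
  + wedge24 (da j6) q j0 j1 j2 j3 j4 j5 = 0.
Proof.
move=> dcl; have H i j k : da i j k = da j i k - da k i j.
  by apply/eqP; rewrite -subr_eq0 -[X in _ == X](dcl i j k); apply/eqP; ring.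
rewrite /wedge24 (H j0 j1 j2) (H j0 j1 j3) (H j0 j1 j4) (H j0 j1 j5)
    (H j0 j1 j6) (H j0 j2 j3) (H j0 j2 j4) (H j0 j2 j5) (H j0 j2 j6)
    (H j0 j3 j4) (H j0 j3 j5) (H j0 j3 j6) (H j0 j4 j5) (H j0 j4 j6)
    (H j0 j5 j6) (H j1 j2 j3) (H j1 j2 j4) (H j1 j2 j5) (H j1 j2 j6)
    (H j1 j3 j4) (H j1 j3 j5) (H j1 j3 j6) (H j1 j4 j5) (H j1 j4 j6)
    (H j1 j5 j6) (H j2 j3 j4) (H j2 j3 j5) (H j2 j3 j6) (H j2 j4 j5)
    (H j2 j4 j6) (H j2 j5 j6) (H j3 j4 j5) (H j3 j4 j6) (H j3 j5 j6)
    (H j4 j5 j6).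
by ring.
Qed.

(** The part of d(a /\ q) in which q is differentiated is a /\ dq. *)
Lemma wedge24_closedr a (dq : T -> T -> T -> T -> T -> K) j0 j1 j2 j3 j4 j5 j6 :
  (forall i1 i2 i3 i4 i5, dq i1 i2 i3 i4 i5 - dq i2 i1 i3 i4 i5
     + dq i3 i1 i2 i4 i5 - dq i4 i1 i2 i3 i5 + dq i5 i1 i2 i3 i4 = 0) ->
  wedge24 a (dq j0) j1 j2 j3 j4 j5 j6 - wedge24 a (dq j1) j0 j2 j3 j4 j5 j6
  + wedge24 a (dq j2) j0 j1 j3 j4 j5 j6 - wedge24 a (dq j3) j0 j1 j2 j4 j5 j6
  + wedge24 a (dq j4) j0 j1 j2 j3 j5 j6 - wedge24 a (dq j5) j0 j1 j2 j3 j4 j6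
  + wedge24 a (dq j6) j0 j1 j2 j3 j4 j5 = 0.
Proof.
move=> dcl; have H i1 i2 i3 i4 i5 : dq i1 i2 i3 i4 i5 = dq i2 i1 i3 i4 i5
     - dq i3 i1 i2 i4 i5 + dq i4 i1 i2 i3 i5 - dq i5 i1 i2 i3 i4.
  apply/eqP; rewrite -subr_eq0 -[X in _ == X](dcl i1 i2 i3 i4 i5); apply/eqP.
  by ring.
rewrite /wedge24 (H j0 j1 j2 j3 j4) (H j0 j1 j2 j3 j5) (H j0 j1 j2 j3 j6)
    (H j0 j1 j2 j4 j5) (H j0 j1 j2 j4 j6) (H j0 j1 j2 j5 j6) (H j0 j1 j3 j4 j5)
    (H j0 j1 j3 j4 j6) (H j0 j1 j3 j5 j6) (H j0 j1 j4 j5 j6) (H j0 j2 j3 j4 j5)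
    (H j0 j2 j3 j4 j6) (H j0 j2 j3 j5 j6) (H j0 j2 j4 j5 j6) (H j0 j3 j4 j5 j6)
    (H j1 j2 j3 j4 j5) (H j1 j2 j3 j4 j6) (H j1 j2 j3 j5 j6) (H j1 j2 j4 j5 j6)
    (H j1 j3 j4 j5 j6) (H j2 j3 j4 j5 j6).
by ring.
Qed.

(** Leibniz rule for pf4, with db k i j for the derivative of b i j in the
    direction k. *)
Definition dpf4 b (db : T -> T -> T -> K) k i1 i2 i3 i4 : K :=
  (db k i1 i2 * b i3 i4 + b i1 i2 * db k i3 i4)
  - (db k i1 i3 * b i2 i4 + b i1 i3 * db k i2 i4)
  + (db k i1 i4 * b i2 i3 + b i1 i4 * db k i2 i3).

Lemma dpf4_closed b db i1 i2 i3 i4 i5 :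
  (forall i j k, db i j k - db j i k + db k i j = 0) ->
  dpf4 b db i1 i2 i3 i4 i5 - dpf4 b db i2 i1 i3 i4 i5
  + dpf4 b db i3 i1 i2 i4 i5 - dpf4 b db i4 i1 i2 i3 i5
  + dpf4 b db i5 i1 i2 i3 i4 = 0.
Proof.
move=> dcl; have H i j k : db i j k = db j i k - db k i j.
  by apply/eqP; rewrite -subr_eq0 -[X in _ == X](dcl i j k); apply/eqP; ring.
rewrite /dpf4 (H i1 i2 i3) (H i1 i2 i4) (H i1 i2 i5) (H i1 i3 i4) (H i1 i3 i5)
  (H i1 i4 i5) (H i2 i3 i4) (H i2 i3 i5) (H i2 i4 i5) (H i3 i4 i5).
by ring.
Qed.

End Pfaffian.

Section Nondegenerate.
Variables (K : idomainType) (T : Type) (b : T -> T -> K).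
Variables (i0 i1 i2 i3 i4 i5 : T).
Hypothesis bskew : forall i j, b i j = - b j i.
Hypothesis bdiag : forall i, b i i = 0.
Hypothesis three0 : 3%:R != 0 :> K.

Let row v0 v1 v2 v3 v4 v5 k : K := v0 * b i0 k + v1 * b i1 k + v2 * b i2 k
  + v3 * b i3 k + v4 * b i4 k + v5 * b i5 k.

Hypothesis nondegenerate : forall v0 v1 v2 v3 v4 v5 : K,
  let r := row v0 v1 v2 v3 v4 v5 in
  r i0 = 0 -> r i1 = 0 -> r i2 = 0 -> r i3 = 0 -> r i4 = 0 -> r i5 = 0 ->
  [/\ v0 = 0, v1 = 0 & v2 = 0] /\ [/\ v3 = 0, v4 = 0 & v5 = 0].

(** For each index, the five sub-Pfaffians of order 4 which avoid it are the
    coordinates, up to sign, of a vector that b sends to a multiple of the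
    Pfaffian. If the latter is zero and b is nondegenerate, they all vanish.
    But a vanishing sub-Pfaffian on i, j, k, l for all l says that the vector
    (b j k, - b i k, b i j) supported on i, j, k is in the kernel; so the whole
    row of index i0 is zero, and b is degenerate. *)
Lemma wedge24_neq0 : wedge24 b (pf4 b) i0 i1 i2 i3 i4 i5 != 0.
Proof.
apply/eqP => P0.
have Pf0 : b i0 i1 * pf4 b i2 i3 i4 i5 - b i0 i2 * pf4 b i1 i3 i4 i5
    + b i0 i3 * pf4 b i1 i2 i4 i5 - b i0 i4 * pf4 b i1 i2 i3 i5
    + b i0 i5 * pf4 b i1 i2 i3 i4 = 0.
  apply: (mulfI three0); rewrite mulr0 -P0 /wedge24 /pf4; ring.
have E10 := bskew i1 i0; have E20 := bskew i2 i0; have E30 := bskew i3 i0.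
have E40 := bskew i4 i0; have E50 := bskew i5 i0; have E21 := bskew i2 i1.
have E31 := bskew i3 i1; have E41 := bskew i4 i1; have E51 := bskew i5 i1.
have E32 := bskew i3 i2; have E42 := bskew i4 i2; have E52 := bskew i5 i2.
have E43 := bskew i4 i3; have E53 := bskew i5 i3; have E54 := bskew i5 i4.
have sk := (bdiag, (E10, E20, E30, E40, E50, (E21, E31, E41, E51),
  (E32, E42, E52), (E43, E53, E54))).
have [[q1234 q0234 q0134] [q0124 q0123 _]] := nondegenerate
  (v0 := pf4 b i1 i2 i3 i4) (v1 := - pf4 b i0 i2 i3 i4)
      (v2 := pf4 b i0 i1 i3 i4)
  (v3 := - pf4 b i0 i1 i2 i4) (v4 := pf4 b i0 i1 i2 i3) (v5 := 0)
  ltac:(rewrite /row /pf4 !sk; ring) ltac:(rewrite /row /pf4 !sk; ring)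
  ltac:(rewrite /row /pf4 !sk; ring) ltac:(rewrite /row /pf4 !sk; ring)
  ltac:(rewrite /row /pf4 !sk; ring)
  ltac:(rewrite /row -[RHS]Pf0 /pf4; ring).
have [[_ q0235 q0135] [q0125 _ _]] := nondegenerate
  (v0 := pf4 b i1 i2 i3 i5) (v1 := - pf4 b i0 i2 i3 i5)
      (v2 := pf4 b i0 i1 i3 i5) (v3 := - pf4 b i0 i1 i2 i5) (v4 := 0)
      (v5 := pf4 b i0 i1 i2 i3)
  ltac:(rewrite /row /pf4 !sk; ring)
  ltac:(rewrite /row /pf4 !sk; ring)
  ltac:(rewrite /row /pf4 !sk; ring)
  ltac:(rewrite /row /pf4 !sk; ring)
  ltac:(rewrite /row -[RHS]oppr0 -[in RHS]Pf0 /pf4 !sk; ring)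
  ltac:(rewrite /row /pf4 !sk; ring).
have [[_ q0245 q0145] [_ _ _]] := nondegenerate
  (v0 := pf4 b i1 i2 i4 i5) (v1 := - pf4 b i0 i2 i4 i5)
      (v2 := pf4 b i0 i1 i4 i5) (v3 := 0) (v4 := - pf4 b i0 i1 i2 i5)
      (v5 := pf4 b i0 i1 i2 i4)
  ltac:(rewrite /row /pf4 !sk; ring)
  ltac:(rewrite /row /pf4 !sk; ring)
  ltac:(rewrite /row /pf4 !sk; ring)
  ltac:(rewrite /row -[RHS]Pf0 /pf4 !sk; ring)
  ltac:(rewrite /row /pf4 !sk; ring)
  ltac:(rewrite /row /pf4 !sk; ring).
have [[_ b02 b01] _] := nondegenerate
  (v0 := b i1 i2) (v1 := - b i0 i2) (v2 := b i0 i1) (v3 := 0) (v4 := 0)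
      (v5 := 0)
  ltac:(rewrite /row !sk; ring)
  ltac:(rewrite /row !sk; ring)
  ltac:(rewrite /row !sk; ring)
  ltac:(rewrite /row -[RHS]q0123 /pf4 !sk; ring)
  ltac:(rewrite /row -[RHS]oppr0 -[in RHS]q0124 /pf4 !sk; ring)
  ltac:(rewrite /row -[RHS]oppr0 -[in RHS]q0125 /pf4 !sk; ring).
have [[_ b03 _] _] := nondegenerate
  (v0 := b i1 i3) (v1 := - b i0 i3) (v2 := 0) (v3 := b i0 i1) (v4 := 0)
      (v5 := 0)
  ltac:(rewrite /row !sk; ring)
  ltac:(rewrite /row !sk; ring)
  ltac:(rewrite /row -[RHS]oppr0 -[in RHS]q0123 /pf4 !sk; ring)
  ltac:(rewrite /row !sk; ring)
  ltac:(rewrite /row -[RHS]q0134 /pf4 !sk; ring)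
  ltac:(rewrite /row -[RHS]q0135 /pf4 !sk; ring).
have [[_ b04 _] _] := nondegenerate
  (v0 := b i1 i4) (v1 := - b i0 i4) (v2 := 0) (v3 := 0) (v4 := b i0 i1)
      (v5 := 0)
  ltac:(rewrite /row !sk; ring)
  ltac:(rewrite /row !sk; ring)
  ltac:(rewrite /row -[RHS]q0124 /pf4 !sk; ring)
  ltac:(rewrite /row -[RHS]oppr0 -[in RHS]q0134 /pf4 !sk; ring)
  ltac:(rewrite /row !sk; ring)
  ltac:(rewrite /row -[RHS]q0145 /pf4 !sk; ring).
have [[_ b05 _] _] := nondegenerate
  (v0 := b i1 i5) (v1 := - b i0 i5) (v2 := 0) (v3 := 0) (v4 := 0)
      (v5 := b i0 i1)
  ltac:(rewrite /row !sk; ring)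
  ltac:(rewrite /row !sk; ring)
  ltac:(rewrite /row -[RHS]q0125 /pf4 !sk; ring)
  ltac:(rewrite /row -[RHS]oppr0 -[in RHS]q0135 /pf4 !sk; ring)
  ltac:(rewrite /row -[RHS]oppr0 -[in RHS]q0145 /pf4 !sk; ring)
  ltac:(rewrite /row !sk; ring).
have zr x : - x = 0 :> K -> x = 0 by move/eqP; rewrite oppr_eq0 => /eqP.
have onev := nondegenerate
  (v0 := 1) (v1 := 0) (v2 := 0) (v3 := 0) (v4 := 0) (v5 := 0)
  ltac:(rewrite /row !sk; ring)
  ltac:(by rewrite /row mul1r b01 !mul0r !addr0)
  ltac:(by rewrite /row mul1r (zr _ b02) !mul0r !addr0)
  ltac:(by rewrite /row mul1r (zr _ b03) !mul0r !addr0)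
  ltac:(by rewrite /row mul1r (zr _ b04) !mul0r !addr0)
  ltac:(by rewrite /row mul1r (zr _ b05) !mul0r !addr0).
by case: onev => - [] /eqP; rewrite oner_eq0.
Qed.

End Nondegenerate.

(** * Divergence of the dual of a closed six-form *)

Lemma wedge24_leibniz (K : comRingType) (T : Type) (a da : T -> T -> K)
    (q dq : T -> T -> T -> T -> K) i1 i2 i3 i4 i5 i6 :
  wedge24 da q i1 i2 i3 i4 i5 i6 + wedge24 a dq i1 i2 i3 i4 i5 i6 =
  (da i1 i2 * q i3 i4 i5 i6 + a i1 i2 * dq i3 i4 i5 i6) -
      (da i1 i3 * q i2 i4 i5 i6 + a i1 i3 * dq i2 i4 i5 i6) +
      (da i1 i4 * q i2 i3 i5 i6 + a i1 i4 * dq i2 i3 i5 i6)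
    - (da i1 i5 * q i2 i3 i4 i6 + a i1 i5 * dq i2 i3 i4 i6) +
        (da i1 i6 * q i2 i3 i4 i5 + a i1 i6 * dq i2 i3 i4 i5) +
        (da i2 i3 * q i1 i4 i5 i6 + a i2 i3 * dq i1 i4 i5 i6)
    - (da i2 i4 * q i1 i3 i5 i6 + a i2 i4 * dq i1 i3 i5 i6) +
        (da i2 i5 * q i1 i3 i4 i6 + a i2 i5 * dq i1 i3 i4 i6) -
        (da i2 i6 * q i1 i3 i4 i5 + a i2 i6 * dq i1 i3 i4 i5)
    + (da i3 i4 * q i1 i2 i5 i6 + a i3 i4 * dq i1 i2 i5 i6) -
        (da i3 i5 * q i1 i2 i4 i6 + a i3 i5 * dq i1 i2 i4 i6) +
        (da i3 i6 * q i1 i2 i4 i5 + a i3 i6 * dq i1 i2 i4 i5)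
    + (da i4 i5 * q i1 i2 i3 i6 + a i4 i5 * dq i1 i2 i3 i6) -
        (da i4 i6 * q i1 i2 i3 i5 + a i4 i6 * dq i1 i2 i3 i5) +
        (da i5 i6 * q i1 i2 i3 i4 + a i5 i6 * dq i1 i2 i3 i4).
Proof. by rewrite /wedge24; ring. Qed.

Section DiffWedge.
Variables (R : realType) (V : normedModType R) (z : V).

Section Operations.
Variables (f df g dg : V -> R^o).
Hypotheses (fd : is_diff z f df) (gd : is_diff z g dg).

Lemma is_diff_add :
  is_diff z (fun y => f y + g y : R^o) (fun v => df v + dg v : R^o).
Proof. exact: is_diffD. Qed.

Lemma is_diff_sub :
  is_diff z (fun y => f y - g y : R^o) (fun v => df v - dg v : R^o).
Proof. exact: is_diffB. Qed.

Lemma is_diff_mul :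
  is_diff z (fun y => f y * g y : R^o) (fun v => df v * g z + f z * dg v : R^o).
Proof.
apply: is_diff_eq (is_diffM fd gd) _; apply/funext => v; rewrite !fctE addrC.
by congr (_ + _); exact: mulrC.
Qed.

End Operations.

Variables (T : Type) (a b : V -> T -> T -> R).
Hypothesis ad : forall i j, differentiable (fun y => a y i j : R^o) z.
Hypothesis bd : forall i j, differentiable (fun y => b y i j : R^o) z.
Local Notation da := (fun i j v => 'd (fun y => a y i j : R^o) z v : R).
Local Notation db := (fun i j v => 'd (fun y => b y i j : R^o) z v : R).

Lemma is_diff_pf4 i1 i2 i3 i4 :
  is_diff z (fun y => pf4 (b y) i1 i2 i3 i4 : R^o)
    (fun v => (db i1 i2 v * b z i3 i4 + b z i1 i2 * db i3 i4 v)
      - (db i1 i3 v * b z i2 i4 + b z i1 i3 * db i2 i4 v)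
      + (db i1 i4 v * b z i2 i3 + b z i1 i4 * db i2 i3 v) : R^o).
Proof.
have M i j k l := is_diff_mul (differentiableP (bd i j))
    (differentiableP (bd k l)).
exact: (is_diff_add (is_diff_sub (M i1 i2 i3 i4) (M i1 i3 i2 i4))
    (M i1 i4 i2 i3)).
Qed.

Variable q : V -> T -> T -> T -> T -> R.
Hypothesis qd : forall i j k l, differentiable (fun y => q y i j k l : R^o) z.

Lemma is_diff_wedge24 i1 i2 i3 i4 i5 i6 :
  is_diff z (fun y => wedge24 (a y) (q y) i1 i2 i3 i4 i5 i6 : R^o)
    (fun v => wedge24 (fun i j => da i j v) (q z) i1 i2 i3 i4 i5 i6 +
      wedge24 (a z) (fun i j k l => 'd (fun y => q y i j k l : R^o) z v)
        i1 i2 i3 i4 i5 i6 : R^o).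
Proof.
have D i j k l m n := is_diff_mul (differentiableP (ad i j))
    (differentiableP (qd k l m n)).
under [X in is_diff_def _ _ X]eq_fun do rewrite wedge24_leibniz.
exact: (is_diff_add (is_diff_sub
    (is_diff_add (is_diff_add
    (is_diff_sub (is_diff_add
    (is_diff_sub (is_diff_add
    (is_diff_sub (is_diff_add
    (is_diff_add (is_diff_sub (is_diff_add (is_diff_sub (D i1 i2 i3 i4 i5 i6)
  (D i1 i3 i2 i4 i5 i6))
  (D i1 i4 i2 i3 i5 i6))
  (D i1 i5 i2 i3 i4 i6))
  (D i1 i6 i2 i3 i4 i5))
  (D i2 i3 i1 i4 i5 i6))
  (D i2 i4 i1 i3 i5 i6))
  (D i2 i5 i1 i3 i4 i6))
  (D i2 i6 i1 i3 i4 i5))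
  (D i3 i4 i1 i2 i5 i6))
  (D i3 i5 i1 i2 i4 i6))
  (D i3 i6 i1 i2 i4 i5))
  (D i4 i5 i1 i2 i3 i6))
  (D i4 i6 i1 i2 i3 i5))
  (D i5 i6 i1 i2 i3 i4)).
Qed.

End DiffWedge.

Section Flux.
Variable R : realType.
Local Notation V := 'cV[R]_7.
Local Notation o k := (inord k : 'I_7).
Local Notation e i := (delta_mx i 0 : V).

(** The vector field dual to half of the 6-form a /\ b /\ b on R^7. *)
Definition flux (a b : 'I_7 -> 'I_7 -> R) (l : 'I_7) : R :=
  let w := wedge24 a (pf4 b) in
  match nat_of_ord l with
  | 0 => w (o 1) (o 2) (o 3) (o 4) (o 5) (o 6)
  | 1 => - w (o 0) (o 2) (o 3) (o 4) (o 5) (o 6)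
  | 2 => w (o 0) (o 1) (o 3) (o 4) (o 5) (o 6)
  | 3 => - w (o 0) (o 1) (o 2) (o 4) (o 5) (o 6)
  | 4 => w (o 0) (o 1) (o 2) (o 3) (o 5) (o 6)
  | 5 => - w (o 0) (o 1) (o 2) (o 3) (o 4) (o 6)
  | _ => w (o 0) (o 1) (o 2) (o 3) (o 4) (o 5)
  end.

Lemma sum7 (F : 'I_7 -> R) : \sum_i F i =
  F (o 0) + F (o 1) + F (o 2) + F (o 3) + F (o 4) + F (o 5) + F (o 6).
Proof.
rewrite !big_ord_recl big_ord0 addr0 !addrA.
by do 6?[congr (_ + _)]; congr F; apply/val_inj; rewrite /= inordK.
Qed.

(** The divergence of the dual field is the exterior derivative of the
    6-form. *)
Lemma divergence_flux (a b : V -> 'I_7 -> 'I_7 -> R) z :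
  let da k i j := 'd (fun y => a y i j : R^o) z (e k) in
  let db k i j := 'd (fun y => b y i j : R^o) z (e k) in
  (forall i j, differentiable (fun y => a y i j : R^o) z) ->
  (forall i j, differentiable (fun y => b y i j : R^o) z) ->
  (forall i j k, da i j k - da j i k + da k i j = 0) ->
  (forall i j k, db i j k - db j i k + db k i j = 0) ->
  \sum_i 'd (fun y => flux (a y) (b y) i : R^o) z (e i) = 0.
Proof.
move=> da db ad bd dacl dbcl.
have P i1 i2 i3 i4 := is_diff_pf4 bd i1 i2 i3 i4.
have Pd i1 i2 i3 i4 := @ex_diff _ _ _ _ _ _ _ (P i1 i2 i3 i4).
have dQ k : (fun i1 i2 i3 i4 => 'd (fun y => pf4 (b y) i1 i2 i3 i4 : R^o) z
    (e k))
    = dpf4 (b z) db k.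
  do 4!(apply/funext => ?).
  by rewrite (congr1 (@^~ (e k)) (@diff_val _ _ _ _ _ _ _ (P _ _ _ _))).
pose dw k i1 i2 i3 i4 i5 i6 := wedge24 (da k) (pf4 (b z)) i1 i2 i3 i4 i5 i6 +
  wedge24 (a z) (dpf4 (b z) db k) i1 i2 i3 i4 i5 i6.
have W k i1 i2 i3 i4 i5 i6 :
    'd (fun y => wedge24 (a y) (pf4 (b y)) i1 i2 i3 i4 i5 i6 : R^o) z (e k) =
    dw k i1 i2 i3 i4 i5 i6.
  have w := is_diff_wedge24 ad Pd i1 i2 i3 i4 i5 i6.
  by rewrite (congr1 (@^~ (e k)) (@diff_val _ _ _ _ _ _ _ w)) dQ.
have WN k i1 i2 i3 i4 i5 i6 :
    'd (fun y => - wedge24 (a y) (pf4 (b y)) i1 i2 i3 i4 i5 i6 : R^o) z (e k) =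
    - dw k i1 i2 i3 i4 i5 i6.
  have w := @ex_diff _ _ _ _ _ _ _ (is_diff_wedge24 ad Pd i1 i2 i3 i4 i5 i6).
  by apply: (etrans (congr1 (@^~ (e k)) (diffN w))); congr (- _); exact: W.
have E0 : 'd (fun y => flux (a y) (b y) (o 0) : R^o) z (e (o 0)) =
    dw (o 0) (o 1) (o 2) (o 3) (o 4) (o 5) (o 6).
  have -> : (fun y => flux (a y) (b y) (o 0) : R^o) =
      (fun y => wedge24 (a y) (pf4 (b y)) (o 1) (o 2) (o 3) (o 4) (o 5) (o 6)).
    by apply/funext => y; rewrite /flux inordK.
  exact: W.
have E1 : 'd (fun y => flux (a y) (b y) (o 1) : R^o) z (e (o 1)) =
    - dw (o 1) (o 0) (o 2) (o 3) (o 4) (o 5) (o 6).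
  have -> : (fun y => flux (a y) (b y) (o 1) : R^o) =
      (fun y => - wedge24 (a y) (pf4 (b y)) (o 0) (o 2) (o 3) (o 4) (o 5)
          (o 6)).
    by apply/funext => y; rewrite /flux inordK.
  exact: WN.
have E2 : 'd (fun y => flux (a y) (b y) (o 2) : R^o) z (e (o 2)) =
    dw (o 2) (o 0) (o 1) (o 3) (o 4) (o 5) (o 6).
  have -> : (fun y => flux (a y) (b y) (o 2) : R^o) =
      (fun y => wedge24 (a y) (pf4 (b y)) (o 0) (o 1) (o 3) (o 4) (o 5) (o 6)).
    by apply/funext => y; rewrite /flux inordK.
  exact: W.
have E3 : 'd (fun y => flux (a y) (b y) (o 3) : R^o) z (e (o 3)) =
    - dw (o 3) (o 0) (o 1) (o 2) (o 4) (o 5) (o 6).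
  have -> : (fun y => flux (a y) (b y) (o 3) : R^o) =
      (fun y => - wedge24 (a y) (pf4 (b y)) (o 0) (o 1) (o 2) (o 4) (o 5)
          (o 6)).
    by apply/funext => y; rewrite /flux inordK.
  exact: WN.
have E4 : 'd (fun y => flux (a y) (b y) (o 4) : R^o) z (e (o 4)) =
    dw (o 4) (o 0) (o 1) (o 2) (o 3) (o 5) (o 6).
  have -> : (fun y => flux (a y) (b y) (o 4) : R^o) =
      (fun y => wedge24 (a y) (pf4 (b y)) (o 0) (o 1) (o 2) (o 3) (o 5) (o 6)).
    by apply/funext => y; rewrite /flux inordK.
  exact: W.
have E5 : 'd (fun y => flux (a y) (b y) (o 5) : R^o) z (e (o 5)) =
    - dw (o 5) (o 0) (o 1) (o 2) (o 3) (o 4) (o 6).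
  have -> : (fun y => flux (a y) (b y) (o 5) : R^o) =
      (fun y => - wedge24 (a y) (pf4 (b y)) (o 0) (o 1) (o 2) (o 3) (o 4)
          (o 6)).
    by apply/funext => y; rewrite /flux inordK.
  exact: WN.
have E6 : 'd (fun y => flux (a y) (b y) (o 6) : R^o) z (e (o 6)) =
    dw (o 6) (o 0) (o 1) (o 2) (o 3) (o 4) (o 5).
  have -> : (fun y => flux (a y) (b y) (o 6) : R^o) =
      (fun y => wedge24 (a y) (pf4 (b y)) (o 0) (o 1) (o 2) (o 3) (o 4) (o 5)).
    by apply/funext => y; rewrite /flux inordK.
  exact: W.
have H1 := wedge24_closedl (pf4 (b z)) (o 0) (o 1) (o 2) (o 3) (o 4) (o 5) (o 6)
    dacl.
have H2 := wedge24_closedr (a z) (o 0) (o 1) (o 2) (o 3) (o 4) (o 5) (o 6)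
  (fun i1 i2 i3 i4 i5 => dpf4_closed (b z) i1 i2 i3 i4 i5 dbcl).
have comb (x0 x1 x2 x3 x4 x5 x6 y0 y1 y2 y3 y4 y5 y6 : R) :
    (x0 + y0) + - (x1 + y1) + (x2 + y2) + - (x3 + y3) + (x4 + y4)
    + - (x5 + y5) + (x6 + y6) =
    (x0 - x1 + x2 - x3 + x4 - x5 + x6) + (y0 - y1 + y2 - y3 + y4 - y5 + y6).
  by ring.
have D0 : dw (o 0) (o 1) (o 2) (o 3) (o 4) (o 5) (o 6)
      + - dw (o 1) (o 0) (o 2) (o 3) (o 4) (o 5) (o 6)
      + dw (o 2) (o 0) (o 1) (o 3) (o 4) (o 5) (o 6)
      + - dw (o 3) (o 0) (o 1) (o 2) (o 4) (o 5) (o 6)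
      + dw (o 4) (o 0) (o 1) (o 2) (o 3) (o 5) (o 6)
      + - dw (o 5) (o 0) (o 1) (o 2) (o 3) (o 4) (o 6)
      + dw (o 6) (o 0) (o 1) (o 2) (o 3) (o 4) (o 5)
     = 0 :> R.
  by rewrite /dw comb H1 H2 addr0.
apply: (etrans (sum7 _)).
exact: (etrans (congr2 +%R (congr2 +%R (congr2 +%R (congr2 +%R (congr2 +%R
  (congr2 +%R E0 E1) E2) E3) E4) E5) E6) D0).
Qed.

End Flux.

Section CkWedge.
Variables (R : realType) (V : normedModType R) (T : Type) (k : nat).
Variables (a b : V -> T -> T -> R).
Hypothesis ad : forall i j, Ck k setT (fun y => a y i j : R^o).
Hypothesis bd : forall i j, Ck k setT (fun y => b y i j : R^o).

Lemma CkN (f : V -> R^o) : Ck k setT f -> Ck k setT (fun y => - f y : R^o).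
Proof.
move=> fC; have c : Ck k setT (fun=> -1 : R^o) := @Ck_cst R V R^o k setT (-1).
by apply: (Ck_ext openT _ (CkM openT c fC)) => y _; rewrite mulN1r.
Qed.

Lemma CkB (f g : V -> R^o) : Ck k setT f -> Ck k setT g ->
  Ck k setT (fun y => f y - g y : R^o).
Proof. by move=> fC gC; exact: (CkD openT fC (CkN gC)). Qed.

Lemma Ck_pf4 i1 i2 i3 i4 : Ck k setT (fun y => pf4 (b y) i1 i2 i3 i4 : R^o).
Proof.
have M i j i' j' := CkM openT (bd i j) (bd i' j').
exact: (CkD openT (CkB (M i1 i2 i3 i4) (M i1 i3 i2 i4)) (M i1 i4 i2 i3)).
Qed.

Lemma Ck_wedge24 i1 i2 i3 i4 i5 i6 :
  Ck k setT (fun y => wedge24 (a y) (pf4 (b y)) i1 i2 i3 i4 i5 i6 : R^o).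
Proof.
have D i j l m n o := CkM openT (ad i j) (Ck_pf4 l m n o).
exact: (CkD openT (CkB (CkD openT
    (CkD openT (CkB (CkD openT
    (CkB (CkD openT (CkB (CkD openT
    (CkD openT (CkB (CkD openT (CkB (D i1 i2 i3 i4 i5 i6)
  (D i1 i3 i2 i4 i5 i6))
  (D i1 i4 i2 i3 i5 i6))
  (D i1 i5 i2 i3 i4 i6))
  (D i1 i6 i2 i3 i4 i5))
  (D i2 i3 i1 i4 i5 i6))
  (D i2 i4 i1 i3 i5 i6))
  (D i2 i5 i1 i3 i4 i6))
  (D i2 i6 i1 i3 i4 i5))
  (D i3 i4 i1 i2 i5 i6))
  (D i3 i5 i1 i2 i4 i6))
  (D i3 i6 i1 i2 i4 i5))
  (D i4 i5 i1 i2 i3 i6))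
  (D i4 i6 i1 i2 i3 i5))
  (D i5 i6 i1 i2 i3 i4)).
Qed.

End CkWedge.

Section CkFlux.
Variables (R : realType) (V : normedModType R) (a b : V -> 'I_7 -> 'I_7 -> R).

Lemma Ck_flux k (i : 'I_7) :
  (forall i j, Ck k setT (fun y => a y i j : R^o)) ->
  (forall i j, Ck k setT (fun y => b y i j : R^o)) ->
  Ck k setT (fun y => flux (a y) (b y) i : R^o).
Proof.
move=> ad bd; have W := Ck_wedge24 ad bd; rewrite /flux.
case: (nat_of_ord i) => [|[|[|[|[|[|l]]]]]];
  by [exact: W|exact: CkN (W _ _ _ _ _ _)].
Qed.

End CkFlux.

Section FluxValues.
Variable R : realType.
Implicit Types a b : 'I_7 -> 'I_7 -> R.

Lemma flux_l0 b i : flux (fun _ _ => 0) b i = 0.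
Proof.
have W q i1 i2 i3 i4 i5 i6 : wedge24 (fun _ _ : 'I_7 => 0 : R) q i1 i2 i3 i4 i5
    i6 = 0.
  by rewrite /wedge24 !mul0r !subr0 !addr0.
by rewrite /flux; case: (nat_of_ord i) => [|[|[|[|[|[|l]]]]]]; rewrite W ?oppr0.
Qed.

Lemma flux_r0 a b i : (forall i j, b i j = 0) -> flux a b i = 0.
Proof.
move=> b0; have W i1 i2 i3 i4 i5 i6 : wedge24 a (pf4 b) i1 i2 i3 i4 i5 i6 = 0.
  by rewrite /wedge24 /pf4 !b0 !mulr0 !subr0 !addr0 !mulr0 !subr0 !addr0.
by rewrite /flux; case: (nat_of_ord i) => [|[|[|[|[|[|l]]]]]]; rewrite W ?oppr0.
Qed.

(** The component along the coordinate 0 does not see the directions of that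
    coordinate. *)
Lemma flux_first a b a' b' :
    (forall i j, i != ord0 -> j != ord0 -> a i j = a' i j) ->
  (forall i j, i != ord0 -> j != ord0 -> b i j = b' i j) ->
  flux a b ord0 = flux a' b' ord0.
Proof.
move=> aE bE; have n0 k : (0 < k < 7)%N -> (inord k : 'I_7) != ord0.
  by move=> /andP[k0 k7]; rewrite -val_eqE /= inordK// -lt0n.
by rewrite /flux /= /wedge24 /pf4 !aE ?n0// !bE ?n0//.
Qed.

End FluxValues.


(** * The curvature form of a family of complex structures *)

Lemma mxtraceN (R : pzRingType) n (A : 'M[R]_n) : \tr (- A) = - \tr A.
Proof. exact: raddfN. Qed.

Section Trace.
Variables (R : realType) (V : normedModType R) (N : nat).

Lemma is_diff_trace (A : V -> 'M[R]_N.+1) x : differentiable A x ->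
  is_diff x (fun y => \tr (A y) : R^o) (fun v => \tr ('d A x v) : R^o).
Proof.
move=> Ad; have d i := differentiableP (differentiable_entry i i Ad).
apply: (is_diff_eq (is_diff_big_sum d)); apply/funext => v.
by apply: eq_bigr => i _; rewrite diff_entry.
Qed.

Lemma Ck_trace k (A : V -> 'M[R]_N.+1) : Ck k setT A ->
  Ck k setT (fun y => \tr (A y) : R^o).
Proof.
move=> ACk; apply: (Ck_sum openT) => i; exact: (Ck_entry openT ACk i i).
Qed.

Lemma schwarz_mx (A : V -> 'M[R]_N.+1) x u v : Ck 2 setT A ->
  'd (fun y => 'd A y u) x v = 'd (fun y => 'd A y v) x u.
Proof.
move=> ACk; have Ad y : differentiable A y := Ck_differentiable ACk I.
have E w i j : (fun y => ('d A y w) i j : R^o) =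
    (fun y => 'd (fun y => A y i j : R^o) y w : R^o).
  by apply/funext => y; rewrite diff_entry.
have dd w y : differentiable (fun y => 'd A y w) y :=
  Ck_differentiable (Ck_diff w ACk) I.
apply/matrixP => i j; rewrite -!diff_entry // !E.
exact: (schwarz _ _ _ (Ck_entry openT ACk i j)).
Qed.

End Trace.

Section ComplexStructures.
Variables (R : realType) (V : normedModType R) (N : nat).
Variable Q : V -> 'M[R]_N.+1.
Hypothesis QC : Ck 2 setT Q.
Hypothesis Q2 : forall x, Q x *m Q x = - 1%:M.

(** When Q ^ 2 = -1 this is, up to a constant factor, the trace of Q times the
    curvature of the connection on the trivial bundle obtained by projecting
    the flat one so as to preserve Q. *)
Definition curv (u v : V) (x : V) : R := \tr (Q x *m 'd Q x u *m 'd Q x v).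

Let Qd x : differentiable Q x := Ck_differentiable QC I.

Lemma diff_anticomm x u : 'd Q x u *m Q x = - (Q x *m 'd Q x u).
Proof.
have [_ E] := diff_mulmx u (Qd x) (Qd x).
have c : (fun x => Q x *m Q x) = cst (- 1%:M) by apply/funext => y; rewrite Q2.
have Z : 'd Q x u *m Q x + Q x *m 'd Q x u = 0 :> 'M[R]_N.+1.
  by rewrite -E c; exact: (congr1 (@^~ u) (diff_cst _ _)).
by apply/eqP; rewrite -addr_eq0; apply/eqP.
Qed.

Lemma curv_skew u v x : curv u v x = - curv v u x.
Proof.
by rewrite /curv mxtrace_mulC mulmxA diff_anticomm mulNmx mxtraceN.
Qed.

Lemma curv_Ck1 u v : Ck 1 setT (fun x => curv u v x : R^o).
Proof.
apply: Ck_trace; apply: (Ck_mulmx openT); last exact: Ck_diff.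
by apply: (Ck_mulmx openT); [exact: CkS|exact: Ck_diff].
Qed.

(** Moving Q around the trace of Q Q A B C, where A, B and C anticommute with
    Q, changes its sign. *)
Lemma trace_diff3 x u v w : \tr ('d Q x u *m 'd Q x v *m 'd Q x w) = 0.
Proof.
set A := 'd Q x u; set B := 'd Q x v; set D := 'd Q x w.
have QA := diff_anticomm x u; have QB := diff_anticomm x v.
have QD := diff_anticomm x w; rewrite -/A -/B -/D in QA QB QD.
have E : A *m B *m D *m Q x = - (Q x *m (A *m B *m D)).
  by rewrite -mulmxA QD mulmxN mulmxA -(mulmxA A B (Q x)) QB mulmxN mulmxA QA
      !mulNmx
    !opprK !mulmxA.
have : \tr (A *m B *m D *m Q x *m Q x) = - \tr (A *m B *m D *m Q x *m Q x).
  by rewrite {1}E mulNmx mxtraceN mxtrace_mulC mulmxA mxtrace_mulC mulmxA.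
rewrite -mulmxA Q2 mulmxN mulmx1 mxtraceN opprK => h.
by lra.
Qed.

Lemma diff_curv u v w x : 'd (fun y => curv v w y : R^o) x u =
  \tr (Q x *m 'd (fun y => 'd Q y v) x u *m 'd Q x w) +
  \tr (Q x *m 'd Q x v *m 'd (fun y => 'd Q y w) x u).
Proof.
have dd w y : differentiable (fun y => 'd Q y w) y :=
  Ck_differentiable (Ck_diff w QC) I.
have [d1 E1] := diff_mulmx u (Qd x) (dd v x).
have [d2 E2] := diff_mulmx u d1 (dd w x).
have t := is_diff_trace d2.
apply: (etrans (congr1 (@^~ u) (@diff_val _ _ _ _ _ _ _ t))); cbv beta.
apply: (etrans (congr1 mxtrace
    (etrans E2 (congr2 +%R (congr1 (mulmx^~ _) E1) erefl)))).
by rewrite /= mulmxDl !mxtraceD trace_diff3 add0r.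
Qed.

(** The second derivatives cancel in pairs since the first ones anticommute
    with Q. *)
Let second_order_cancel (P A B D S1 S2 S3 T1 T2 T3 : 'M[R]_N.+1) :
  S1 = S2 -> T1 = S3 -> T2 = T3 -> B *m P = - (P *m B) ->
  (\tr (P *m S1 *m D) + \tr (P *m B *m T1)) -
  (\tr (P *m S2 *m D) + \tr (P *m A *m T2)) +
  (\tr (P *m S3 *m B) + \tr (P *m A *m T3)) = 0 :> R.
Proof.
move=> -> -> -> BP.
have -> : \tr (P *m S3 *m B) = - \tr (P *m B *m S3).
  by rewrite mxtrace_mulC mulmxA BP mulNmx mxtraceN.
by ring.
Qed.

Lemma curv_closed u v w x :
  'd (fun y => curv v w y : R^o) x u - 'd (fun y => curv u w y : R^o) x v
  + 'd (fun y => curv u v y : R^o) x w = 0.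
Proof.
have E := congr2 +%R (congr2 (fun a b : R => a - b) (diff_curv u v w x)
  (diff_curv v u w x)) (diff_curv w u v x).
apply: (etrans E); apply: second_order_cancel; last exact: diff_anticomm.
- exact: schwarz_mx QC.
- exact: schwarz_mx QC.
- exact: schwarz_mx QC.
Qed.

End ComplexStructures.

(** * The Levi-Civita connection of the sphere *)

Section Dot.
Variables (R : realType) (n : nat).
Implicit Types (u v w : 'cV[R]_n).

Lemma dotE u v : dot u v = (u^T *m v) 0 0.
Proof. by rewrite /dot mxE; apply: eq_bigr => i _; rewrite mxE. Qed.

Lemma dotC u v : dot u v = dot v u.
Proof. by apply: eq_bigr => i _; rewrite mulrC. Qed.

Lemma dotDr u v w : dot u (v + w) = dot u v + dot u w.
Proof. by rewrite !dotE mulmxDr mxE. Qed.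

Lemma dotNr u v : dot u (- v) = - dot u v.
Proof. by rewrite !dotE mulmxN mxE. Qed.

Lemma dotBr u v w : dot u (v - w) = dot u v - dot u w.
Proof. by rewrite dotDr dotNr. Qed.

Lemma dotZr (c : R) u v : dot u (c *: v) = c * dot u v.
Proof. by rewrite !dotE -scalemxAr mxE. Qed.

Lemma dotDl u v w : dot (u + v) w = dot u w + dot v w.
Proof. by rewrite dotC dotDr !(dotC w). Qed.

Lemma dotBl u v w : dot (u - v) w = dot u w - dot v w.
Proof. by rewrite dotC dotBr !(dotC w). Qed.

Lemma dotZl (c : R) u v : dot (c *: u) v = c * dot u v.
Proof. by rewrite dotC dotZr dotC. Qed.

Lemma dot_ge0 u : 0 <= dot u u.
Proof. by apply: sumr_ge0 => i _; rewrite -expr2 sqr_ge0. Qed.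

Lemma dot_eq0 u : dot u u = 0 -> u = 0.
Proof.
move=> /eqP; rewrite psumr_eq0 => [/allP u0|i _]; last by rewrite -expr2
    sqr_ge0.
apply/colP => i; rewrite mxE; have := u0 i; rewrite mem_index_enum => /(_ isT).
by rewrite /= mulf_eq0 orbb => /eqP.
Qed.

End Dot.

Section SphereCalculus.
Variables (R : realType) (n : nat).
Implicit Types (p q : sphere R n) (v w : 'cV[R]_n.+1).

Lemma dot_sphere p : dot (val p) (val p) = 1.
Proof. exact: (eqP (valP p)). Qed.

(** One local extension computes the differential at all points of its
    domain. *)
Lemma smooth_mapP (W : normedModType R) (f : sphere R n -> W) p : smooth_map f
    ->
  exists U F, [/\ open U, U (val p), Csmooth U F,
    forall q, U (val q) -> F (val q) = f q &
    forall q v, U (val q) -> tangent q v -> dsphere f q v = 'd F (val q) v].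
Proof.
move=> /(_ p)[U [F [Uo Up FC Ff]]]; exists U, F; split=> // q v Uq qv.
exact: (dsphere_ext qv Uo Uq (Ck_differentiable (FC 1%N) Uq) Ff).
Qed.

Lemma Csmooth_diff (W : normedModType R) (U : set 'cV[R]_n.+1)
  (F : 'cV[R]_n.+1 -> W) x : Csmooth U F -> U x -> differentiable F x.
Proof. by move=> FC; exact: (Ck_differentiable (FC 1%N)). Qed.

Lemma smooth_map_global (W : normedModType R) (F : 'cV[R]_n.+1 -> W) :
  Csmooth setT F -> smooth_map (fun q : sphere R n => F (val q)).
Proof. by move=> FC p; exists setT, F; split => //; exact: openT. Qed.

Lemma dsphere_global (W : normedModType R) (F : 'cV[R]_n.+1 -> W) p v :
  differentiable F (val p) -> tangent p v ->
  dsphere (fun q : sphere R n => F (val q)) p v = 'd F (val p) v.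
Proof. by move=> Fd pv; apply: (dsphere_ext (U := setT)) => //; exact: openT.
    Qed.

Section Product.
Variables (a b c : nat).
Variables (A : sphere R n -> 'M[R]_(a.+1, b.+1))
    (B : sphere R n -> 'M[R]_(b.+1, c.+1)).
Hypotheses (As : smooth_map A) (Bs : smooth_map B).

Lemma smooth_mulmx : smooth_map (fun q => A q *m B q).
Proof.
move=> p; have [U [F [Uo Up FC FA]]] := As p; have [U' [G [U'o U'p GC GB]]] :=
    Bs p.
have UUo := openI Uo U'o.
exists (U `&` U'), (fun x => F x *m G x); split => //.
  move=> k; apply: (Ck_mulmx UUo).
    by apply: Ck_sub (FC k); exact: subIsetl.
  by apply: Ck_sub (GC k); exact: subIsetr.
by move=> q [Uq U'q]; rewrite FA// GB.
Qed.

Lemma dsphere_mulmx p v : tangent p v ->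
  dsphere (fun q => A q *m B q) p v =
  dsphere A p v *m B p + A p *m dsphere B p v.
Proof.
move=> pv; have [U [F [Uo Up FC FA dA]]] := smooth_mapP p As.
have [U' [G [U'o U'p GC GB dB]]] := smooth_mapP p Bs.
have Fd := Csmooth_diff FC Up; have Gd := Csmooth_diff GC U'p.
have [FGd dFG] := diff_mulmx v Fd Gd.
rewrite dA// dB// -FA// -GB// -dFG.
apply: (dsphere_ext pv (openI Uo U'o) _ FGd) => // q [Uq U'q].
by rewrite FA// GB.
Qed.

End Product.

Lemma dsphere_dot (Y Z : sphere R n -> 'cV[R]_n.+1) p v :
  smooth_map Y -> smooth_map Z -> tangent p v ->
  dsphere (fun q => dot (Y q) (Z q) : R^o) p v =
  dot (dsphere Y p v) (Z p) + dot (Y p) (dsphere Z p v).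
Proof.
move=> Ys Zs pv; have [U [F [Uo Up FC FY dY]]] := smooth_mapP p Ys.
have [U' [G [U'o U'p GC GZ dZ]]] := smooth_mapP p Zs.
have Fd := Csmooth_diff FC Up; have Gd := Csmooth_diff GC U'p.
have d i : is_diff (val p) (fun x => F x i 0 * G x i 0 : R^o)
    (fun v => 'd F (val p) v i 0 * G (val p) i 0
            + F (val p) i 0 * 'd G (val p) v i 0 : R^o).
  have m := is_diff_mul (differentiableP (differentiable_entry i 0 Fd))
    (differentiableP (differentiable_entry i 0 Gd)).
  by apply: (is_diff_eq m); apply/funext => w; rewrite !diff_entry.
have D := is_diff_big_sum d.
apply: (etrans (dsphere_ext pv (openI Uo U'o) (conj Up U'p)
    (@ex_diff _ _ _ _ _ _ _ D) _)).
  by move=> q [Uq U'q]; rewrite FY// GZ.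
apply: (etrans (congr1 (@^~ v) (@diff_val _ _ _ _ _ _ _ D))).
by rewrite big_split /= dY// dZ// -FY// -GZ.
Qed.

(** Every tangent vector is thus the value of a vector field, which lets one
    test connections on vector fields only. *)
Definition tangent_field v q : 'cV[R]_n.+1 := v - dot (val q) v *: val q.

Lemma tangent_fieldE p v : tangent p v -> tangent_field v p = v.
Proof. by move=> pv; rewrite /tangent_field pv scale0r subr0. Qed.

Lemma Csmooth_id : Csmooth setT (id : 'cV[R]_n.+1 -> 'cV[R]_n.+1).
Proof.
case=> [|k]; first by move=> x _; exact: cvg_id.
split=> [x _|v]; first exact: (@ex_diff _ _ _ _ _ _ _ (is_diff_id x)).
have -> : (fun x : 'cV[R]_n.+1 => 'd id x v) = cst v.
  by apply/funext => x; exact: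
      (congr1 (@^~ v) (@diff_val _ _ _ _ _ _ _ (is_diff_id x))).
exact: Ck_cst.
Qed.

Lemma Csmooth_dotl w : Csmooth setT (fun x : 'cV[R]_n.+1 => dot x w : R^o).
Proof.
move=> k; apply: (Ck_sum openT) => i; apply: (CkM openT).
  exact: (Ck_entry openT (Csmooth_id k) i 0).
exact: (Ck_cst k setT (w i 0 : R^o)).
Qed.

Lemma tangent_field_vector v : vector_field (tangent_field v).
Proof.
split=> [|p]; last first.
  by rewrite /tangent /tangent_field dotBr dotZr dot_sphere mulr1 subrr.
apply: (@smooth_map_global _ (fun x => v - dot x v *: x)) => k.
apply: (CkD openT); first exact: (Ck_cst k setT v).
apply: (Ck_mx openT) => i j.
apply: (@Ck_ext _ _ _ k (fun x => -1 * (dot x v * x i j) : R^o)) => [|x _|].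
- exact: openT.
- by rewrite !mxE mulN1r.
apply: (CkM openT); first exact: (Ck_cst k setT (-1 : R^o)).
by apply: (CkM openT); [exact: Csmooth_dotl|exact:
    (Ck_entry openT (Csmooth_id k) i j)].
Qed.

End SphereCalculus.

Section LeviCivita.
Variables (R : realType) (n : nat) (nabla : connection R n).
Hypothesis nablaP : levi_civita nabla.
Implicit Types (p q : sphere R n) (v w : 'cV[R]_n.+1).
Implicit Types (X Y Z : sphere R n -> 'cV[R]_n.+1).

Let nablaA : affine_connection nabla. Proof. by case: nablaP. Qed.
Let nablaT : torsion_free nabla. Proof. by case: nablaP. Qed.
Let nablaM : metric_connection nabla. Proof. by case: nablaP. Qed.

(** Comparing with the derivative in the ambient space, projected or not, is
    the same against tangent vectors. *)
Definition defect p X Y := nabla p (X p) Y - dsphere Y p (X p).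

Lemma dsphere_height w p v : tangent p v ->
  dsphere (fun q => dot (val q) w : R^o) p v = dot v w.
Proof.
move=> pv; have d i : is_diff (val p)
    (fun x : 'cV[R]_n.+1 => x i 0 * w i 0 : R^o)
    (fun v => v i 0 * w i 0 : R^o).
  have m := is_diff_mul (is_diff_coord (val p) i 0)
      (is_diff_cst (w i 0 : R^o) (val p)).
  by apply: (is_diff_eq m); apply/funext => u; rewrite fctE mulr0 addr0.
have D := is_diff_big_sum d.
apply: (etrans (@dsphere_global _ _ _ (fun x => dot x w : R^o) p v
  (@ex_diff _ _ _ _ _ _ _ D) pv)).
exact: (congr1 (@^~ v) (@diff_val _ _ _ _ _ _ _ D)).
Qed.

Lemma dsphere_height2 w p Y v : vector_field Y -> tangent p v ->
  dsphere (fun q => dsphere (fun q => dot (val q) w : R^o) q (Y q) : R^o) p v =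
  dot (dsphere Y p v) w.
Proof.
move=> [Ys Yt] pv.
have ws : smooth_map (cst w : sphere R n -> 'cV[R]_n.+1).
  by apply: (@smooth_map_global _ _ _ (cst w)) => k; exact: Ck_cst.
have w0 : dsphere (cst w : sphere R n -> 'cV[R]_n.+1) p v = 0.
  apply: (etrans (@dsphere_global _ _ _ (cst w) p v (differentiable_cst _ _)
      pv)).
  exact: (congr1 (@^~ v) (diff_cst _ _)).
have E : (fun q => dsphere (fun q => dot (val q) w : R^o) q (Y q) : R^o) =
    (fun q => dot (Y q) (cst w q)).
  by apply/funext => q; exact: dsphere_height.
apply: (etrans (congr1 (fun g : sphere R n -> R^o => dsphere g p v) E)).
apply: (etrans (dsphere_dot Ys ws pv)).
have d00 (u : 'cV[R]_n.+1) : dot u 0 = 0 by rewrite -(scale0r u) dotZr mul0r.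
by apply: (etrans (congr1 (fun u => dot _ w + dot (Y p) u) w0)); rewrite d00
    addr0.
Qed.

(** Torsion freeness, tested on the linear functions <., w>, whose second
    derivatives do not contribute. *)
Lemma defect_sym p X Y w : vector_field X -> vector_field Y ->
  dot (defect p X Y) w = dot (defect p Y X) w.
Proof.
move=> Xv Yv; have [Xs Xt] := Xv; have [Ys Yt] := Yv.
have fs : smooth_map (fun q : sphere R n => dot (val q) w : R^o).
  exact: (smooth_map_global (Csmooth_dotl w)).
have nt : tangent p (nabla p (X p) Y - nabla p (Y p) X).
  rewrite /tangent dotBr (nabla_tangent nablaA (Xt p) Yv).
  by rewrite (nabla_tangent nablaA (Yt p) Xv) subrr.
have := etrans (esym (congr2 (fun a b : R => a - b)
    (dsphere_height2 w Yv (Xt p)) (dsphere_height2 w Xv (Yt p))))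
  (etrans (nablaT p Xv Yv fs) (dsphere_height w nt)).
rewrite dotBl => E.
have alg (a b c d : R) : a - b = c - d -> c - a = d - b by move=> ?; lra.
exact: (etrans (dotBl _ _ w) (etrans (alg _ _ _ _ E) (esym (dotBl _ _ w)))).
Qed.

Lemma defect_skew p X Y Z : vector_field X -> vector_field Y -> vector_field Z
    ->
  dot (defect p X Y) (Z p) = - dot (defect p X Z) (Y p).
Proof.
move=> [_ Xt] Yv Zv; have [Ys _] := Yv; have [Zs _] := Zv.
have E := etrans (esym (dsphere_dot Ys Zs (Xt p))) (nablaM Yv Zv (Xt p)).
have alg (a b c d : R) : a + b = c + d -> c - a = - (d - b) by move=> ?; lra.
apply: (etrans (dotBl _ _ (Z p)) (etrans (alg _ _ _ _ E) _)).
by apply: congr1; rewrite -dotBr dotC.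
Qed.

(** The defect is symmetric in its first two arguments because nabla and the
    projected derivative are torsion free, and skew in the last two because
    both are metric; such a trilinear expression vanishes, as in the
    derivation of the Koszul formula. *)
Lemma defect0 p X Y Z : vector_field X -> vector_field Y -> vector_field Z ->
  dot (defect p X Y) (Z p) = 0.
Proof.
move=> Xv Yv Zv.
have alg (a b c d e f : R) :
  a = b -> b = - c -> c = d -> d = - e -> e = f -> a = - f -> a = 0.
  by move=> *; lra.
exact: (alg _ _ _ _ _ _ (defect_sym p (Z p) Xv Yv) (defect_skew p Yv Xv Zv)
  (defect_sym p (X p) Yv Zv) (defect_skew p Zv Yv Xv)
  (defect_sym p (Y p) Zv Xv) (defect_skew p Xv Yv Zv)).
Qed.

Lemma levi_civitaE p v Y : tangent p v -> vector_field Y ->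
  nabla p v Y = dsphere Y p v - dot (val p) (dsphere Y p v) *: val p.
Proof.
move=> pv Yv; apply/subr0_eq; set u := nabla p v Y - _.
have ut : tangent p u.
  rewrite /tangent /u !dotBr (nabla_tangent nablaA pv Yv) dotZr dot_sphere.
  by rewrite mulr1 subrr subr0.
apply: dot_eq0; rewrite {1}/u opprB addrA addrAC dotDl dotZl ut mulr0 addr0.
have := defect0 p (tangent_field_vector v) Yv (tangent_field_vector u).
by rewrite /defect !tangent_fieldE.
Qed.

Definition tangent_proj p : 'M[R]_n.+1 := 1%:M - val p *m (val p)^T.

Lemma tangent_projE p (u : 'cV[R]_n.+1) :
  tangent_proj p *m u = u - dot (val p) u *: val p.
Proof.
rewrite mulmxBl mul1mx -mulmxA; congr (_ - _).
by apply/colP => i; rewrite !mxE big_ord_recl big_ord0 addr0 -dotE mulrC.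
Qed.

Lemma tangent_proj_tangent p u : tangent p (tangent_proj p *m u).
Proof.
by rewrite /tangent tangent_projE dotBr dotZr dot_sphere mulr1 subrr.
Qed.

Lemma tangent_proj_id p u : tangent p u -> tangent_proj p *m u = u.
Proof. by move=> pu; rewrite tangent_projE pu scale0r subr0. Qed.

(** The tangential projection P satisfies J P = P J = J, so that only the
    tangential part of dJ survives. *)
Lemma covariant_derivativeP (J : sphere R n -> 'M[R]_n.+1) p v :
  smooth_map J -> (forall q, tangent_endo q (J q)) -> tangent p v ->
  is_covariant_derivative nabla J p v
    (tangent_proj p *m dsphere J p v *m tangent_proj p).
Proof.
move=> Js Jt pv; split; first split.
- rewrite -mulmxA tangent_projE dot_sphere scale1r subrr mulmx0.
  by [].
- by move=> u _; rewrite -!mulmxA; exact: tangent_proj_tangent.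
move=> Y Yv; have [Ys Yt] := Yv.
have JYv : vector_field (fun q => J q *m Y q).
  by split=> [|q]; [exact: smooth_mulmx|apply: (Jt q).2].
rewrite (levi_civitaE pv JYv) (levi_civitaE pv Yv) -!tangent_projE.
rewrite dsphere_mulmx// (mulmxDr _ (dsphere J p v *m Y p)).
rewrite -(mulmxA _ (tangent_proj p) (Y p)).
rewrite (tangent_proj_id (Yt p)) -(mulmxA (tangent_proj p)).
have -> : tangent_proj p *m (J p *m dsphere Y p v) = J p *m
    (tangent_proj p *m dsphere Y p v).
  have E : J p *m dsphere Y p v = J p *m (tangent_proj p *m dsphere Y p v).
    by rewrite tangent_projE mulmxBr -scalemxAr (Jt p).1 scaler0 subr0.
  by rewrite {1}E tangent_proj_id//; apply: (Jt p).2; exact: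
      tangent_proj_tangent.
by rewrite addrK.
Qed.

End LeviCivita.

(** * A chart collapsing the outside of a ball to a point *)

Section PositivePart.
Variable R : realType.
Implicit Types s t h : R.

Definition pos s : R := Num.max 0 s.

Lemma posM s : s * pos s = pos s ^+ 2.
Proof. by rewrite /pos; case: (leP 0 s) => ?; rewrite ?mulr0 ?expr0n ?expr2.
    Qed.

(** The square of the positive part is C^1 with a 2-Lipschitz derivative; this
    gives the derivative at 0 and elsewhere at once. *)
Lemma pos_sq_taylor s h :
  `|pos (h + s) ^+ 2 - (pos s ^+ 2 + 2 * pos s * h)| <= h ^+ 2.
Proof.
rewrite ler_norml /pos.
by case: (leP 0 s) => s0; case: (leP 0 (h + s)) => hs0; apply/andP; split; nra.
Qed.

Lemma is_diff_pos_sq s :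
  is_diff (s : R^o) (fun t : R^o => pos t ^+ 2 : R^o)
    (fun h : R^o => 2 * pos s * h : R^o).
Proof.
have c := @scaler_continuous R R^o (2 * pos s).
have E : (fun t : R^o => pos t ^+ 2 : R^o) \o shift (s : R^o) =
    cst (pos s ^+ 2 : R^o) + *:%R (2 * pos s) +o_ 0 id.
  apply/eqaddoP => _/posnumP[e].
  have he : \forall h \near (0 : R^o), `|h| < e%:num.
    by exists e%:num => //= y; rewrite /= sub0r normrN.
  apply: filterS he => h he; rewrite !fctE /=.
  apply: (le_trans (pos_sq_taylor s h)).
  by rewrite -[leLHS]ger0_norm ?sqr_ge0// normrX expr2 ler_wpM2r// ltW.
have dE := diff_unique c E.
by apply: DiffDef; [apply/diff_locallyP; rewrite dE; split|exact: dE].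
Qed.

Variable V : normedModType R.
Implicit Types (g : V -> R^o) (x v : V).

Lemma is_diff_comp_pos_sq g x : differentiable g x ->
  is_diff x (fun y => pos (g y) ^+ 2 : R^o)
    (fun v => 2 * pos (g x) * 'd g x v : R^o).
Proof.
by move=> gd; have := is_diff_comp (differentiableP gd) (is_diff_pos_sq (g x)).
Qed.

Lemma continuous_pos g x : {for x, continuous g} ->
  {for x, continuous (fun y => pos (g y) : R^o)}.
Proof.
move=> gc; have -> : (fun y => pos (g y) : R^o) = (fun y => (g y + `|g y|) / 2).
  apply/funext => y; rewrite /pos; case: (leP 0 (g y)) => g0.
    by rewrite ger0_norm//; lra.
  by rewrite ltr0_norm//; lra.
apply: continuousM; last exact: cst_continuous.
by apply: continuousD => //; apply: (continuous_comp gc); exact: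
    norm_continuous.
Qed.

Lemma Ck1_pos_sq g : Ck 1 setT g -> Ck 1 setT (fun y => pos (g y) ^+ 2 : R^o).
Proof.
move=> gC; have gd y : differentiable g y := Ck_differentiable gC I.
split=> [x _|v]; first exact:
    (@ex_diff _ _ _ _ _ _ _ (is_diff_comp_pos_sq (gd x))).
have -> : (fun x => 'd (fun y => pos (g y) ^+ 2 : R^o) x v) =
    (fun x => 2 * pos (g x) * 'd g x v : R^o).
  apply/funext => x.
  exact: (congr1 (@^~ v) (@diff_val _ _ _ _ _ _ _
      (is_diff_comp_pos_sq (gd x)))).
have c2 : Ck 0 setT (fun=> 2 : R^o) := @Ck_cst R V R^o 0 setT 2.
apply: (CkM openT) (Ck_diff v gC); apply: (CkM openT c2).
by move=> x _; apply: continuous_pos; exact: differentiable_continuous.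
Qed.

Lemma is_diff_comp_pos_cube g x : differentiable g x ->
  is_diff x (fun y => pos (g y) ^+ 3 : R^o)
    (fun v => 3 * pos (g x) ^+ 2 * 'd g x v : R^o).
Proof.
move=> gd; have p := is_diff_mul (differentiableP gd) (is_diff_comp_pos_sq gd).
have -> : (fun y => pos (g y) ^+ 3 : R^o) = (fun y => g y * pos (g y) ^+ 2).
  apply/funext => y; have alg (a c : R) : a * c = c ^+ 2 -> c ^+ 3 = a * c ^+ 2.
    by move=> E; rewrite [in RHS]expr2 [in RHS]mulrA E -exprSr.
  exact: alg (posM (g y)).
apply: (is_diff_eq p); apply/funext => v.
have alg (a b c d : R) : a * c = b -> d * b + a * (2 * c * d) = 3 * b * d.
  by move=> <-; ring.
exact: (alg _ _ _ _ (posM (g x))).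
Qed.

Lemma Ck2_pos_cube g : Ck 2 setT g -> Ck 2 setT (fun y => pos (g y) ^+ 3 : R^o).
Proof.
move=> gC; have gd y : differentiable g y := Ck_differentiable gC I.
split=> [x _|v]; first exact:
    (@ex_diff _ _ _ _ _ _ _ (is_diff_comp_pos_cube (gd x))).
have -> : (fun x => 'd (fun y => pos (g y) ^+ 3 : R^o) x v) =
    (fun x => 3 * pos (g x) ^+ 2 * 'd g x v : R^o).
  apply/funext => x.
  exact: (congr1 (@^~ v) (@diff_val _ _ _ _ _ _ _
      (is_diff_comp_pos_cube (gd x)))).
have c3 : Ck 1 setT (fun=> 3 : R^o) := @Ck_cst R V R^o 1 setT 3.
apply: (CkM openT) (Ck_diff v gC); apply: (CkM openT c3).
exact: Ck1_pos_sq (CkS gC).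
Qed.

End PositivePart.

Section Chart.
Variables (R : realType) (m : nat).
Local Notation V := 'cV[R]_m.+1.
Implicit Types (x v : V).

(** The cube makes the cutoff of class C^2. The constant 5 makes it vanish at
    distance 1 / 2 from the origin, hence near the boundary of the unit cube
    centred there. *)
Definition cutoff x : R := pos (1 - 5 * dot x x) ^+ 3.

Definition denom x : R := dot x x + cutoff x ^+ 2.

Definition ratio x : R := cutoff x * (2 / denom x).

Definition pole : 'cV[R]_m.+2 := delta_mx 0 0.

Definition incl : 'M[R]_(m.+2, m.+1) := \matrix_(i, j) (i == lift ord0 j)%:R.

(** The inverse stereographic projection of x / cutoff x, written so as to make
    sense when the cutoff vanishes; it then takes the value pole, and the
    outside of a ball is collapsed to that point. *)
Definition chart x : 'cV[R]_m.+2 :=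
  pole + ratio x *: (incl *m x - cutoff x *: pole).

Lemma incl_isometry : incl^T *m incl = 1%:M.
Proof.
apply/matrixP => i j; rewrite !mxE (bigD1 (lift ord0 i)) //= !mxE eqxx mul1r.
rewrite big1 ?addr0 => [|k ki]; last by rewrite !mxE (negbTE ki) mul0r.
by rewrite (inj_eq (@lift_inj _ ord0)).
Qed.

Lemma dot_incl x v : dot (incl *m x) (incl *m v) = dot x v.
Proof. by rewrite !dotE trmx_mul -mulmxA (mulmxA incl^T) incl_isometry mul1mx.
    Qed.

Lemma dot_pole : dot pole pole = 1.
Proof.
rewrite /dot (bigD1 ord0) //= !mxE !eqxx mul1r big1 ?addr0// => i i0.
by rewrite !mxE (negbTE i0) mul0r.
Qed.

Lemma dot_incl_pole x : dot (incl *m x) pole = 0.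
Proof.
rewrite dotC dotE mulmxA (_ : _ *m incl = 0) ?mul0mx ?mxE//.
apply/matrixP => i j; rewrite !mxE big1 // => k _.
rewrite !mxE; case: (eqVneq k 0) => [->|_]; last by rewrite mul0r.
by rewrite (negbTE (neq_lift _ _)) mulr0.
Qed.

Lemma denom_gt0 x : 0 < denom x.
Proof.
rewrite /denom; have := dot_ge0 x; rewrite le_eqVlt => /orP[/eqP x0|x0].
  rewrite -x0 add0r exprn_even_gt0//= /cutoff -x0 mulr0 subr0.
  by rewrite expf_neq0// /pos max_r ?ler01// oner_neq0.
by rewrite ltr_pwDl// sqr_ge0.
Qed.

Lemma chart_sphere x : dot (chart x) (chart x) == 1.
Proof.
rewrite /chart dotDl !dotDr !dotZl !dotZr !dotBl !dotBr !dotZl !dotZr.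
rewrite !(dotC pole (incl *m x)) dot_incl_pole dot_incl dot_pole /ratio.
have := denom_gt0 x; rewrite /denom => d0; apply/eqP; field.
by rewrite gt_eqF.
Qed.

Definition sphere_chart x : sphere R m.+1 := exist _ (chart x) (chart_sphere x).

Lemma Ck_dotxx k : Ck k setT (fun x : V => dot x x : R^o).
Proof.
apply: (Ck_sum openT) => i.
by apply: (CkM openT); exact: (Ck_entry openT (@Csmooth_id R m k) i 0).
Qed.

Lemma is_diff_gap x : is_diff x (fun y : V => 1 - 5 * dot y y : R^o)
  (fun v => - (5 * (2 * dot x v)) : R^o).
Proof.
have c1 := is_diff_cst (1 : R^o) x; have c5 := is_diff_cst (5 : R^o) x.
have d := is_diff_sub c1 (is_diff_mul c5 (is_diff_dotxx x)).
apply: (is_diff_eq d); apply/funext => v.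
have alg (a b : R) : 0 - (0 * a + 5 * b) = - (5 * b) by ring.
exact: alg.
Qed.

Lemma Ck_gap k : Ck k setT (fun y : V => 1 - 5 * dot y y : R^o).
Proof.
have c (a : R) : Ck k setT (fun=> a : R^o) := @Ck_cst R V R^o k setT a.
have d : Ck k setT (fun y : V => 1 + (- 5) * dot y y : R^o).
  by apply: (CkD openT); [exact: c|apply: (CkM openT);
      [exact: c|exact: Ck_dotxx]].
by apply: (Ck_ext openT _ d) => y _; rewrite mulNr.
Qed.

Lemma is_diff_cutoff x : is_diff x (cutoff : V -> R^o)
  (fun v => 3 * pos (1 - 5 * dot x x) ^+ 2 * - (5 * (2 * dot x v)) : R^o).
Proof.
have g := is_diff_gap x.
have c := is_diff_comp_pos_cube (@ex_diff _ _ _ _ _ _ _ g).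
by apply: (is_diff_eq c); apply/funext => v; rewrite diff_val.
Qed.

Lemma Ck_cutoff : Ck 2 setT (cutoff : V -> R^o).
Proof. exact: Ck2_pos_cube (Ck_gap 2). Qed.

Lemma Ck_ratio_factor : Ck 2 setT (fun x => 2 / denom x : R^o).
Proof.
have c : Ck 2 setT (fun=> 2 : R^o) := @Ck_cst R V R^o 2 setT 2.
apply: (CkM openT c); apply: (CkV openT) => [x _|].
  by rewrite gt_eqF// denom_gt0.
apply: (CkD openT); first exact: Ck_dotxx.
exact: (CkM openT Ck_cutoff Ck_cutoff).
Qed.

Lemma Ck_ratio : Ck 2 setT (ratio : V -> R^o).
Proof. exact: (CkM openT Ck_cutoff Ck_ratio_factor). Qed.

Lemma diff_ratio0 x v : cutoff x = 0 -> 'd (cutoff : V -> R^o) x v = 0 ->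
  'd (ratio : V -> R^o) x v = 0.
Proof.
move=> c0 dc0; have cd := differentiableP
    (Ck_differentiable Ck_cutoff (I : setT x)).
have fd := differentiableP (Ck_differentiable Ck_ratio_factor (I : setT x)).
have p := is_diff_mul cd fd.
apply: (etrans (congr1 (@^~ v) (@diff_val _ _ _ _ _ _ _ p))).
have alg (a b c d : R) : a = 0 -> c = 0 -> a * b + c * d = 0.
  by move=> -> ->; ring.
exact: alg.
Qed.

Let inclc i (y : V) : R^o := (incl *m y) i 0.

Lemma is_diff_incl i x : is_diff x (inclc i) (inclc i).
Proof.
have d j := is_diff_mul (is_diff_cst (incl i j : R^o) x) (is_diff_coord x j 0).
have E : inclc i = fun y => \sum_j incl i j * y j 0.
  by apply/funext => y; rewrite /inclc mxE.
rewrite E; apply: (is_diff_eq (is_diff_big_sum d)); apply/funext => v.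
by apply: eq_bigr => j _; rewrite mul0r add0r.
Qed.

Lemma Ck_incl i k : Ck k setT (inclc i).
Proof.
have E : inclc i = fun y => \sum_j incl i j * y j 0.
  by apply/funext => y; rewrite /inclc mxE.
rewrite E; apply: (Ck_sum openT) => j.
have c : Ck k setT (fun=> incl i j : R^o) := @Ck_cst R V R^o k setT (incl i j).
exact: (CkM openT c (Ck_entry openT (@Csmooth_id R m k) j 0)).
Qed.

Let chart_entry i : (fun y => chart y i 0 : R^o) =
  (fun y => pole i 0 + ratio y * (inclc i y - cutoff y * pole i 0)).
Proof. by apply/funext => y; rewrite !mxE /inclc !mxE. Qed.

Lemma Ck_chart : Ck 2 setT chart.
Proof.
apply: (Ck_mx openT) => i j; rewrite ord1 chart_entry.
have c (a : R) : Ck 2 setT (fun=> a : R^o) := @Ck_cst R V R^o 2 setT a.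
apply: (CkD openT (c _)); apply: (CkM openT Ck_ratio).
have d : Ck 2 setT (fun y => inclc i y + cutoff y * - pole i 0 : R^o).
  by apply: (CkD openT (Ck_incl i 2)); apply: (CkM openT Ck_cutoff); exact: c.
by apply: (Ck_ext openT _ d) => y _; rewrite mulrN.
Qed.

Lemma diff_chart x v : 'd chart x v =
  'd (ratio : V -> R^o) x v *: (incl *m x - cutoff x *: pole) +
  ratio x *: (incl *m v - 'd (cutoff : V -> R^o) x v *: pole).
Proof.
have cd := differentiableP (Ck_differentiable Ck_cutoff (I : setT x)).
have rd := differentiableP (Ck_differentiable Ck_ratio (I : setT x)).
have chd := Ck_differentiable Ck_chart (I : setT x).
apply/colP => i; apply: (etrans (esym (diff_entry v i 0 chd))).
rewrite chart_entry; have p0 := is_diff_cst (pole i 0 : R^o) x.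
have d := is_diff_add p0 (is_diff_mul rd (is_diff_sub (is_diff_incl i x)
  (is_diff_mul cd p0))).
apply: (etrans (congr1 (@^~ v) (@diff_val _ _ _ _ _ _ _ d))).
rewrite !mxE /inclc !mxE.
have alg (r dr a da c dc p : R) : 0 +
    (dr * (a - c * p) + r * (da - (dc * p + c * 0)))
   = dr * (a - c * p) + r * (da - dc * p) by ring.
exact: alg.
Qed.

Lemma cutoff_le0 x : 1 - 5 * dot x x <= 0 ->
  cutoff x = 0 /\ forall v, 'd (cutoff : V -> R^o) x v = 0.
Proof.
move=> x0; have p0 : pos (1 - 5 * dot x x) = 0 by rewrite /pos max_l.
split=> [|v]; first by rewrite /cutoff p0 expr0n.
apply: (etrans (congr1 (@^~ v) (@diff_val _ _ _ _ _ _ _ (is_diff_cutoff x)))).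
by rewrite p0 expr0n /= mulr0 mul0r.
Qed.

Lemma diff_chart_outside x v : 1 - 5 * dot x x <= 0 -> 'd chart x v = 0.
Proof.
move=> /cutoff_le0[c0 dc0].
apply: (etrans (diff_chart x v)).
have alg (a b : 'cV[R]_m.+2) (d e : R) : d = 0 -> e = 0 -> d *: a + e *: b = 0.
  by move=> -> ->; rewrite !scale0r addr0.
by apply: alg; [exact: (diff_ratio0 c0 (dc0 v))|rewrite /ratio c0 mul0r].
Qed.

(** Eliminates dr between the components along pole and along the image of
    incl, which are orthogonal. *)
Lemma incl_pole_independent (r dr c dc : R) x v : r != 0 ->
  dr *: (incl *m x - c *: pole) + r *: (incl *m v - dc *: pole) = 0 ->
  forall w, c * dot w v = dc * dot w x.
Proof.
move=> r0 E w.
have d0 (u : 'cV[R]_m.+2) : dot u 0 = 0 by rewrite -(scale0r u) dotZr mul0r.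
have Ep : dr * c + r * dc = 0.
  have := congr1 (dot pole) E; rewrite d0 dotDr !dotZr !dotBr !dotZr dot_pole.
  rewrite !(dotC pole (incl *m _)) !dot_incl_pole => H.
  by lra.
have Ew : dr * dot w x + r * dot w v = 0.
  have := congr1 (dot (incl *m w)) E; rewrite d0 dotDr !dotZr !dotBr !dotZr.
  by rewrite !dot_incl_pole !dot_incl !mulr0 !subr0.
apply: (mulfI r0).
have -> : r * (c * dot w v) = c * (r * dot w v) by ring.
have -> : r * (dc * dot w x) = (r * dc) * dot w x by ring.
have -> : r * dot w v = - (dr * dot w x) by lra.
have -> : r * dc = - (dr * c) by lra.
by ring.
Qed.

(** On the kernel, v is the multiple of x by the logarithmic derivative of the
    cutoff along v. As the cutoff decreases along x, the factor is zero. *)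
Lemma diff_chart_inj x v : 0 < 1 - 5 * dot x x -> 'd chart x v = 0 -> v = 0.
Proof.
move=> s0 E.
have c0 : 0 < cutoff x by rewrite /cutoff exprn_gt0// /pos lt_max s0 orbT.
have r0 : ratio x != 0 by rewrite gt_eqF// mulr_gt0// divr_gt0// denom_gt0.
have := incl_pole_independent r0 (etrans (esym (diff_chart x v)) E).
have := congr1 (@^~ v) (@diff_val _ _ _ _ _ _ _ (is_diff_cutoff x)).
move: ('d _ x v) => dc /= dcE K.
have xv : dot x v = 0.
  have : (cutoff x + 30 * pos (1 - 5 * dot x x) ^+ 2 * dot x x) * dot x v = 0.
    by rewrite mulrDl (K x) dcE; ring.
  move/eqP; rewrite mulf_eq0 => /orP[|/eqP//].
  by rewrite gt_eqF// ltr_pwDl// mulr_ge0 ?dot_ge0// mulr_ge0 ?sqr_ge0.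
apply: dot_eq0; apply: (mulfI (lt0r_neq0 c0)).
by rewrite (K v) dcE xv !mulr0 oppr0 mulr0 mul0r.
Qed.

Lemma diff_chart_tangent x v : tangent (sphere_chart x) ('d chart x v).
Proof.
have chd := differentiableP (Ck_differentiable Ck_chart (I : setT x)).
have d := is_diff_comp chd (is_diff_dotxx (chart x)).
have E : (fun y => dot y y : R^o) \o chart = cst (1 : R^o).
  by apply/funext => y; exact: eqP (chart_sphere y).
have := congr1 (@^~ v) (@diff_val _ _ _ _ _ _ _ d); rewrite E.
move/(etrans (esym (congr1 (@^~ v) (diff_cst (1 : R^o) x)))) => /esym/eqP.
by rewrite /= mulf_eq0 pnatr_eq0 => /eqP.
Qed.

(** The differential is an injective linear map into a hyperplane of the same
    dimension. *)
Lemma diff_chart_surj x w : 0 < 1 - 5 * dot x x -> tangent (sphere_chart x) w ->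
  exists v, 'd chart x v = w.
Proof.
move=> s0 wt; pose D : 'M[R]_(m.+2, m.+1) := \matrix_(i, j) 'd chart x
    (delta_mx j 0) i 0.
have DE v : 'd chart x v = D *m v.
  rewrite [in LHS](cV_sum_delta v) linear_sum; apply/colP => i; rewrite summxE
      mxE.
  by apply: eq_bigr => j _; rewrite linearZ !mxE mulrC.
have Dfree : row_free D^T.
  apply: inj_row_free => u uD; apply: trmx_inj; rewrite trmx0.
  by apply: (diff_chart_inj s0); rewrite DE -[D]trmxK -trmx_mul uD trmx0.
pose N : 'cV[R]_m.+2 := chart x.
have kerE (u : 'rV[R]_m.+2) : (u *m N == 0) = (dot u^T N == 0).
  rewrite dotE trmxK; apply/eqP/eqP => [->|E]; first by rewrite mxE.
  by apply/matrixP => i j; rewrite !ord1 E mxE.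
have DN : (D^T <= kermx N)%MS.
  apply/row_subP => i; apply/sub_kermxP/eqP; rewrite kerE; apply/eqP.
  have -> : (row i D^T)^T = 'd chart x (delta_mx i 0).
    by apply/colP => k; rewrite !mxE.
  by rewrite dotC; exact: diff_chart_tangent.
have rN : \rank N = 1%N.
  rewrite -mxrank_tr rank_rV trmx_eq0.
  case: eqP => // N0; have := eqP (chart_sphere x); rewrite -/N N0.
  by move/eqP; rewrite -(scale0r (0 : 'cV[R]_m.+2)) dotZl mul0r eq_sym oner_eq0.
have : (w^T <= D^T)%MS.
  apply: (@submx_trans _ _ _ _ _ _ (kermx N)).
    by apply/sub_kermxP/eqP; rewrite kerE trmxK dotC; apply/eqP.
  have := mxrank_leqif_sup DN; rewrite mxrank_ker rN (eqP Dfree) subn1 =>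
      -[_ <-].
  by [].
move=> /submxP[u E]; exists u^T; rewrite DE.
by apply: trmx_inj; rewrite trmx_mul trmxK.
Qed.

End Chart.

(** * Stabilisation to a trivial bundle *)

Lemma eq_mulmx_cV (R : pzRingType) a b (A B : 'M[R]_(a, b)) :
  (forall v : 'cV[R]_b, A *m v = B *m v) -> A = B.
Proof. by move=> AB; apply/trmx_inj/row_matrixP => i; apply: trmx_inj;
  rewrite -!tr_col !trmxK !colE AB. Qed.

Section Stabilization.
Variables (R : realType) (n : nat).

(** J completed on the span of the normal u and of an extra vector by a rotation
    of that plane. The formula is linear in (A, u), and therefore commutes with
    differentiation. *)
Definition stab (A : 'M[R]_n.+1) (u : 'cV[R]_n.+1) : 'M[R]_(n.+1 + 1) :=
  block_mx A (- u) u^T 0.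

Lemma mul_stab A u B v : stab A u *m stab B v =
  block_mx (A *m B - u *m v^T) (- (A *m v)) (u^T *m B) (- (u^T *m v)).
Proof.
by rewrite /stab mulmx_block !mulmx0 !mul0mx !addr0 mulNmx !mulmxN.
Qed.

Lemma stab_sq A u : A *m u = 0 -> u^T *m A = 0 -> dot u u = 1 ->
  A *m A = u *m u^T - 1%:M -> stab A u *m stab A u = - 1%:M.
Proof.
move=> Au uA u1 A2; rewrite mul_stab Au uA A2 oppr0 addrAC subrr sub0r.
have -> : u^T *m u = 1%:M.
  by apply/matrixP => i j; rewrite !ord1 -dotE u1 mxE.
by rewrite (scalar_mx_block (n.+1) 1) opp_block_mx !oppr0.
Qed.

(** The blocks of the relation obtained by differentiating stab_sq encode the
    derivatives of A A = u u^T - 1, A u = 0 and u^T A = 0. *)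
Lemma stab_anticomm A u B v : stab B v *m stab A u = - (stab A u *m stab B v) ->
  [/\ B *m A + A *m B = v *m u^T + u *m v^T, B *m u = - (A *m v)
    & v^T *m A = - (u^T *m B)].
Proof.
rewrite !mul_stab opp_block_mx => /eq_block_mx[E1 E2 E3 _]; split.
- by apply/eqP; rewrite -subr_eq0 opprD addrACA E1 opprB addrA subrK subrr.
- by apply: oppr_inj; rewrite E2.
- by [].
Qed.

(** Multiplying out the blocks, with the derivatives of A u = 0 and u^T A = 0
    used to eliminate B and D from the terms that contain u. *)
Lemma trace_stab A u B v D w : stab B v *m stab A u = - (stab A u *m stab B v)
    ->
  stab D w *m stab A u = - (stab A u *m stab D w) ->
  \tr (stab A u *m stab B v *m stab D w) =
  \tr (A *m B *m D) - dot w (A *m v) + 2 * dot v (A *m w).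
Proof.
move=> /stab_anticomm[_ Bu vA] /stab_anticomm[_ Du wA].
rewrite -mulmxA mul_stab /stab mulmx_block mxtrace_block mulmxBr.
rewrite !mul0mx addr0 (mulNmx u) !mxtraceD !mxtraceN (mulmxA A B D).
have tr1 (M : 'M[R]_1) : \tr M = M 0 0 by rewrite /mxtrace big_ord_recl big_ord0
    addr0.
have -> : \tr (A *m (v *m w^T)) = dot w (A *m v).
  by rewrite mulmxA mxtrace_mulC tr1 dotE.
have -> : \tr (u *m (v^T *m D)) = - dot v (A *m w).
  by rewrite mxtrace_mulC tr1 -mulmxA Du mulmxN mxE dotE.
have -> : \tr (u^T *m - (B *m w)) = dot v (A *m w).
  by rewrite mulmxN mxtraceN tr1 mulmxA -[u^T *m B]opprK -vA mulNmx mxE opprK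
    -mulmxA dotE.
by ring.
Qed.

(** Here w = A v, and P B P, P D P are the covariant derivatives of A along v
    and w. Replacing B and D by them in tr (A B D) costs - <w, w>, from the
    normal components. The remaining trace is zero: A anticommutes with both
    factors, and they commute, so it equals its opposite. *)
Lemma trace_stab_taming A u B v D :
  let P := 1%:M - u *m u^T in let w := A *m v in
  A *m u = 0 -> u^T *m A = 0 -> dot u u = 1 ->
  A *m A = u *m u^T - 1%:M -> dot u v = 0 ->
  stab B v *m stab A u = - (stab A u *m stab B v) ->
  stab D w *m stab A u = - (stab A u *m stab D w) ->
  (P *m B *m P) *m (P *m D *m P) = (P *m D *m P) *m (P *m B *m P) ->
  \tr (stab A u *m stab B v *m stab D w) = - 2 * (dot v v + dot w w).
Proof.
move=> P w Au uA u1 A2 uv HB HD comm.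
rewrite (trace_stab HB HD).
have [BA Bu vA] := stab_anticomm HB; have [DA Du wA] := stab_anticomm HD.
have uu : u^T *m u = 1%:M by apply/matrixP => i j; rewrite !ord1 -dotE u1 mxE.
have AP : A *m P = A by rewrite mulmxBr mulmx1 mulmxA Au mul0mx subr0.
have PA : P *m A = A by rewrite mulmxBl mul1mx -mulmxA uA mulmx0 subr0.
have Pu : P *m u = 0 by rewrite mulmxBl mul1mx -mulmxA uu mulmx1 subrr.
have uP : u^T *m P = 0 by rewrite mulmxBr mulmx1 mulmxA uu mul1mx subrr.
have PP : P *m P = P by rewrite {1}/P mulmxBl mul1mx -mulmxA uP mulmx0 subr0.
have Aw : A *m w = - v.
  rewrite mulmxA A2 mulmxBl mul1mx -mulmxA (_ : u^T *m v = 0) ?mulmx0 ?sub0r//.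
  by apply/matrixP => i j; rewrite !ord1 -dotE uv mxE.
set B' := P *m B *m P; set D' := P *m D *m P.
have B'A : B' *m A = - (A *m B').
  apply/eqP; rewrite -addr_eq0; apply/eqP.
  have -> : B' *m A = P *m (B *m A) *m P by rewrite /B' -!mulmxA PA AP.
  have -> : A *m B' = P *m (A *m B) *m P by rewrite /B' !mulmxA AP PA.
  rewrite -mulmxDl -mulmxDr BA (mulmxDr P (v *m _)) mulmxDl.
  by rewrite !mulmxA Pu !mul0mx addr0 -!mulmxA uP !mulmx0.
have t0 : \tr (A *m B' *m D') = 0.
  have E : \tr (A *m B' *m D') = - \tr (A *m B' *m D').
    rewrite -[in LHS](mulmxA A B' D') comm (mulmxA A D' B').
    by rewrite [LHS](mxtrace_mulC (A *m D')) (mulmxA B' A D') B'A mulNmx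
        mxtraceN.
  by lra.
have -> : \tr (A *m B *m D) = - dot w w.
  have E : A *m B *m D = A *m B *m P *m D + (A *m B *m u) *m (u^T *m D).
    by rewrite -(mulmxA _ P) mulmxBl mul1mx mulmxBr !mulmxA subrK.
  have -> : \tr (A *m B *m D) = \tr (A *m B *m P *m D) + \tr
      ((A *m B *m u) *m (u^T *m D)).
    by rewrite {1}E mxtraceD.
  have -> : \tr (A *m B *m P *m D) = \tr (A *m B' *m D').
    have -> : A *m B' *m D' = (A *m B *m P *m D) *m P.
      by rewrite /B' /D' !mulmxA AP -(mulmxA _ P P) PP.
    by rewrite [RHS]mxtrace_mulC !mulmxA PA.
  rewrite t0 add0r mxtrace_mulC -(mulmxA A) Bu -/w.
  have -> : u^T *m D = - (w^T *m A) by rewrite wA opprK.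
  have uw : u^T *m w = 0 by rewrite mulmxA uA mul0mx.
  rewrite mulmxN mulmxN mulNmx opprK -mulmxA (mulmxA A) A2 mulmxBl mul1mx
      -mulmxA uw.
  rewrite mulmx0 sub0r mulmxN mxtraceN; congr (- _).
  by rewrite /mxtrace big_ord_recl big_ord0 addr0 dotE.
by rewrite Aw dotNr; ring.
Qed.

End Stabilization.

Lemma stab_entry (R : realType) (A : 'M[R]_7) (u : 'cV[R]_7) (i j : 'I_8) :
  (stab A u : 'M[R]_8) i j =
  match fintype.split (i : 'I_(7 + 1)), fintype.split (j : 'I_(7 + 1)) with
  | inl a, inl b => A a b
  | inl a, inr _ => - u a 0
  | inr _, inl b => u b 0
  | inr _, inr _ => 0
  end.
Proof.
by rewrite /stab mxE; case: splitP => a _; rewrite mxE; case: splitP => b _;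
    rewrite ?mxE ?ord1.
Qed.

Section DiffHat.
Variables (R : realType) (V : normedModType R).
Variables (A : V -> 'M[R]_7) (u : V -> 'cV[R]_7).

Definition stabf (y : V) : 'M[R]_8 := stab (A y) (u y).

Let stabf_entry i j : (fun y => stabf y i j : R^o) =
  match fintype.split (i : 'I_(7 + 1)), fintype.split (j : 'I_(7 + 1)) with
  | inl a, inl b => fun y => A y a b
  | inl a, inr _ => fun y => - u y a 0
  | inr _, inl b => fun y => u y b 0
  | inr _, inr _ => cst 0
  end.
Proof.
apply/funext => y; apply: (etrans (stab_entry _ _ i j)).
by case: (fintype.split _) => a; case: (fintype.split _).
Qed.

Lemma Ck_stabf k : Ck k setT A -> Ck k setT u -> Ck k setT stabf.
Proof.
move=> Ak uk; apply: (Ck_mx openT) => i j; rewrite stabf_entry.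
case: (fintype.split _) => a; case: (fintype.split _) => b.
- exact: (Ck_entry openT Ak a b).
- have c : Ck k setT (fun=> -1 : R^o) := @Ck_cst R V R^o k setT (-1).
  apply: (Ck_ext openT _ (CkM openT c (Ck_entry openT uk a 0))) => y _.
  by rewrite mulN1r.
- exact: (Ck_entry openT uk b 0).
- exact: Ck_cst.
Qed.

Lemma diff_stabf x v : differentiable A x -> differentiable u x ->
  'd stabf x v = stab ('d A x v) ('d u x v) :> 'M[R]_8.
Proof.
move=> Ad ud.
have hd : differentiable stabf x.
  apply: differentiable_entries => i j; rewrite stabf_entry.
  case: (fintype.split _) => a; case: (fintype.split _) => b.
  - exact: differentiable_entry.
  - by apply: differentiableN; exact: differentiable_entry.
  - exact: differentiable_entry.
  - exact: differentiable_cst.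
apply/matrixP => i j; apply: (etrans (esym (diff_entry v i j hd))).
apply: (etrans _ (esym (stab_entry _ _ i j))); rewrite stabf_entry.
case: (fintype.split _) => a; case: (fintype.split _) => b.
- exact: diff_entry.
- apply: (etrans (congr1 (@^~ v) (diffN (differentiable_entry a 0 ud)))).
  exact: (congr1 -%R (diff_entry v a 0 ud)).
- exact: diff_entry.
- exact: (congr1 (@^~ v) (diff_cst _ _)).
Qed.

End DiffHat.

Section PulledBack.
Variable R : realType.
Variable J : sphere R 6 -> 'M[R]_7.
Hypothesis JP : almost_complex_structure J.
Local Notation V := 'cV[R]_6.
Local Notation chart := (@chart R 5).
Implicit Types (x v w : V) (p : sphere R 6).

Let Js : smooth_map J. Proof. by case: JP. Qed.

Definition Jchart x : 'M[R]_7 := J (sphere_chart x).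

(** On the preimage of the domain of a local extension F of J, the pulled back
    structure is F composed with the chart. *)
Lemma Jchart_local x : exists U : set V, [/\ U x, Ck 2 U Jchart &
  is_diff x Jchart (fun v => dsphere J (sphere_chart x) ('d chart x v))].
Proof.
have [U [F [Uo Ux FC FJ dF]]] := smooth_mapP (sphere_chart x) Js.
have cc : continuous chart.
  by move=> y; exact: (Ck_continuous (@Ck_chart R 5)).
pose U' := chart @^-1` U; have U'o : open U' by apply: open_comp => // y _;
    exact: cc.
have FE y : U' y -> F (chart y) = Jchart y by move=> Uy; exact:
    (FJ (sphere_chart y) Uy).
have U'x : U' x by [].
exists U'; split => //.
  have c2 := Ck_sub (@subsetT _ U') (@Ck_chart R 5).
  have UC := Ck_comp U'o Uo (fun y (Uy : U' y) => Uy) c2 (FC 2%N).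
  exact: (Ck_ext U'o FE UC).
have cd : differentiable chart x := Ck_differentiable (@Ck_chart R 5)
    (I : setT x).
have Fd := Csmooth_diff FC Ux.
have D := diff_open_ext U'o FE U'x (differentiable_comp cd Fd).
apply: (is_diff_eq D); apply/funext => v.
apply: (etrans (congr1 (@^~ v) (diff_comp cd Fd))).
by rewrite dF//; exact: diff_chart_tangent.
Qed.

Lemma Ck_Jchart : Ck 2 setT Jchart.
Proof.
by apply: Ck_cover => x _; have [U [Ux UC _]] := Jchart_local x; exists U.
Qed.

Lemma diff_Jchart x v :
  'd Jchart x v = dsphere J (sphere_chart x) ('d chart x v).
Proof.
have [_ [_ _ D]] := Jchart_local x.
exact: (congr1 (@^~ v) (@diff_val _ _ _ _ _ _ _ D)).
Qed.

Definition stab_chart : V -> 'M[R]_8 := stabf Jchart chart.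

Lemma Ck_stab_chart : Ck 2 setT stab_chart.
Proof. by apply: Ck_stabf; [exact: Ck_Jchart|exact: Ck_chart]. Qed.

Lemma tangent_endo_left p (A : 'M[R]_7) : tangent_endo p A -> (val p)^T *m A =
    0.
Proof.
move=> [Ap At]; apply: eq_mulmx_cV => v; rewrite mul0mx -mulmxA.
have -> : A *m v = A *m (tangent_proj p *m v).
  by rewrite tangent_projE mulmxBr -scalemxAr Ap scaler0 subr0.
apply/matrixP => i j; rewrite !ord1 -dotE mxE.
by apply: At; exact: tangent_proj_tangent.
Qed.

Lemma complex_sq p : J p *m J p = val p *m (val p)^T - 1%:M.
Proof.
case: JP => _ Jt J2; apply: eq_mulmx_cV => v; rewrite -mulmxA.
have -> : J p *m v = J p *m (tangent_proj p *m v).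
  by rewrite tangent_projE mulmxBr -scalemxAr (Jt p).1 scaler0 subr0.
rewrite (J2 p _ (tangent_proj_tangent p v)) /tangent_proj -mulNmx opprB.
by [].
Qed.

Lemma stab_chart_sq x : stab_chart x *m stab_chart x = - 1%:M.
Proof.
have [_ Jt _] := JP; have Jx := Jt (sphere_chart x).
exact: (stab_sq Jx.1 (tangent_endo_left Jx) (dot_sphere (sphere_chart x))
  (complex_sq (sphere_chart x))).
Qed.

Lemma diff_stab_chart x v : 'd stab_chart x v =
  stab (dsphere J (sphere_chart x) ('d chart x v)) ('d chart x v) :> 'M[R]_8.
Proof.
have Jd := Ck_differentiable Ck_Jchart (I : setT x).
have cd := Ck_differentiable (@Ck_chart R 5) (I : setT x).
by rewrite -diff_Jchart; exact: diff_stabf.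
Qed.

End PulledBack.

(** * The curvature form tames the complex structure *)

Section Taming.
Variables (R : realType) (nabla : connection R 6).
Hypothesis nablaP : levi_civita nabla.
Variable J : sphere R 6 -> 'M[R]_7.
Hypothesis JP : almost_complex_structure J.
Hypothesis commJ : forall (p : sphere R 6) (X : 'cV[R]_7), tangent p X ->
  forall A B : 'M[R]_7, is_covariant_derivative nabla J p X A ->
    is_covariant_derivative nabla J p (J p *m X) B -> A *m B = B *m A.
Local Notation V := 'cV[R]_6.
Local Notation chart := (@chart R 5).
Local Notation omega := (curv (stab_chart J)).
Implicit Types (x v w : V).

Let neg_sum_neq0 (a b : R) : 0 < a -> 0 <= b -> - 2 * (a + b) != 0.
Proof. by move=> a0 b0; apply: ltr0_neq0; lra. Qed.

(** The vector w is the one that the chart sends to the image under J of the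
    image of v. *)
Lemma curv_taming x v : 0 < 1 - 5 * dot x x -> v != 0 ->
  exists w, omega v w x != 0.
Proof.
move=> s0 v0; have [Js Jt J2] := JP.
pose p := sphere_chart x; pose X := 'd chart x v.
have pX : tangent p X by exact: diff_chart_tangent.
have X0 : X != 0 by apply: contra v0 => /eqP /(diff_chart_inj s0) ->.
have pY : tangent p (J p *m X) by exact: (Jt p).2.
have [w wE] := diff_chart_surj s0 pY; exists w.
have A0 := diff_anticomm (Ck_stab_chart JP) (stab_chart_sq JP) x v.
have B0 := diff_anticomm (Ck_stab_chart JP) (stab_chart_sq JP) x w.
rewrite !(diff_stab_chart JP) wE -/X -/p in A0 B0.
rewrite /curv !(diff_stab_chart JP) wE -/X -/p.
have comm := commJ pX (covariant_derivativeP nablaP Js Jt pX)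
  (covariant_derivativeP nablaP Js Jt pY).
rewrite (trace_stab_taming (Jt p).1 (tangent_endo_left (Jt p)) (dot_sphere p)
  (complex_sq JP p) pX A0 B0 comm).
apply: neg_sum_neq0; last exact: dot_ge0.
by rewrite lt_def dot_ge0 andbT; apply: contra X0 => /eqP/dot_eq0 ->.
Qed.

Lemma omega_outside x v w : 1 - 5 * dot x x <= 0 -> omega v w x = 0.
Proof.
move=> s0; have dQ0 : 'd (stab_chart J) x v = 0 :> 'M[R]_8.
  apply: (etrans (diff_stab_chart JP x v)); rewrite (diff_chart_outside _ s0).
  rewrite (_ : dsphere J _ 0 = 0); last exact: derive0.
  by rewrite /stab oppr0 trmx0 block_mx0.
by rewrite /curv dQ0 mulmx0 mul0mx linear0.
Qed.

Lemma omega_skew x v w : omega v w x = - omega w v x.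
Proof. exact: (curv_skew (Ck_stab_chart JP) (stab_chart_sq JP)). Qed.

Lemma omega_linear x w (c : 'I_6 -> R) (u : 'I_6 -> V) :
  omega (\sum_i c i *: u i) w x = \sum_i c i * omega (u i) w x.
Proof.
rewrite /curv linear_sum mulmx_sumr mulmx_suml linear_sum.
by apply: eq_bigr => i _; rewrite linearZ -scalemxAr -scalemxAl linearZ.
Qed.

(** The differential of (t, x) |-> x on the standard basis. *)
Definition frame (i : 'I_7) : V := \col_j (i == lift ord0 j)%:R.

Definition omega7 x (i j : 'I_7) : R := omega (frame i) (frame j) x.

Lemma frame_lift j : frame (lift ord0 j) = delta_mx j 0.
Proof.
by apply/colP => i; rewrite !mxE (inj_eq (@lift_inj _ _)) andbT eq_sym.
Qed.

Local Notation o k := (inord k : 'I_7).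

Lemma omega_nondegenerate x v : 0 < 1 - 5 * dot x x ->
  (forall j : 'I_6, omega v (delta_mx j 0) x = 0) -> v = 0.
Proof.
move=> s0 v0; apply/eqP/negPn/negP => vn0.
have [w /eqP[]] := curv_taming s0 vn0; rewrite omega_skew.
rewrite [w in omega w](cV_sum_delta w) omega_linear big1 ?oppr0// => i _.
by rewrite omega_skew v0 oppr0 mulr0.
Qed.

(** Half the density of omega ^ 3 in the chart. *)
Definition cube_density x : R :=
  wedge24 (omega7 x) (pf4 (omega7 x)) (o 1) (o 2) (o 3) (o 4) (o 5) (o 6).

Lemma cube_density_neq0 x : 0 < 1 - 5 * dot x x -> cube_density x != 0.
Proof.
move=> s0; have three0 : 3%:R != 0 :> R by rewrite pnatr_eq0.
have sk i j : omega7 x i j = - omega7 x j i by exact: omega_skew.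
have dg i : omega7 x i i = 0 by have := sk i i; move: (omega7 x i i) => t tt;
    lra.
apply: (wedge24_neq0 sk dg three0) => v0 v1 v2 v3 v4 v5.
pose c (j : 'I_6) := nth 0 [:: v0; v1; v2; v3; v4; v5] j.
pose v : V := \col_j c j.
have lE (j : 'I_6) : lift ord0 j = o j.+1.
  apply: ord_inj; rewrite [RHS]inordK; last by rewrite ltnS ltn_ord.
  by rewrite lift0.
have vE k : omega v (frame k) x = v0 * omega7 x (o 1) k + v1 * omega7 x (o 2) k
  + v2 * omega7 x (o 3) k + v3 * omega7 x (o 4) k + v4 * omega7 x (o 5) k
  + v5 * omega7 x (o 6) k.
  rewrite (cV_sum_delta v) omega_linear !big_ord_recl big_ord0 addr0 !addrA.
  do 5?[congr (_ + _)]; rewrite mxE /c /=; congr (_ * _); rewrite /omega7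
      -frame_lift;
    congr (curv _ (frame _) _ _); apply/val_inj; by rewrite /= inordK.
move=> r r1 r2 r3 r4 r5 r6.
have v00 : v = 0.
  apply: omega_nondegenerate s0 _ => j; rewrite -frame_lift vE -/(r _).
  by rewrite lE; case: j => [[|[|[|[|[|[|j]]]]]] jlt].
have cE j (H : (j < 6)%N) : nth 0 [:: v0; v1; v2; v3; v4; v5] j = 0.
  by have := congr1 (fun u : V => u (Ordinal H) 0) v00; rewrite !mxE.
by split; split; [exact: (cE 0%N)|exact: (cE 1%N)|exact: (cE 2%N)|
  exact: (cE 3%N)|exact: (cE 4%N)|exact: (cE 5%N)].
Qed.

End Taming.

(** * The six-sphere carries no symplectic form *)

Section Contraction.
Variable R : realType.
Local Notation V := 'cV[R]_7.
Implicit Types (z v : V).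

Definition centered z : 'cV[R]_6 := \col_j (z (lift ord0 j) 0 - 2^-1).

(** The homotopy from the constant map to the projection on the last six
    coordinates, both centred on the cube. *)
Definition contraction z : 'cV[R]_6 := z ord0 0 *: centered z.

Lemma Ck_centered k : Ck k setT centered.
Proof.
apply: (Ck_mx openT) => i j; have id7 := @Csmooth_id R 6 k.
have c : Ck k setT (fun=> - 2^-1 : R^o) := @Ck_cst R V R^o k setT (- 2^-1).
apply: (Ck_ext openT _ (CkD openT (Ck_entry openT id7 (lift ord0 i) 0) c)) => z
    _.
by rewrite mxE.
Qed.

Lemma Ck_contraction k : Ck k setT contraction.
Proof.
apply: (Ck_mx openT) => i j; have id7 := @Csmooth_id R 6 k.
apply: (Ck_ext openT _ (CkM openT (Ck_entry openT id7 ord0 0)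
  (Ck_entry openT (@Ck_centered k) i 0))) => z _.
by rewrite !mxE.
Qed.

Let is_diff_centered_entry z i : is_diff z (fun y => centered y i 0 : R^o)
  (fun v => v (lift ord0 i) 0 : R^o).
Proof.
have d := is_diff_sub (is_diff_coord z (lift ord0 i) 0)
    (is_diff_cst (2^-1 : R^o) z).
have -> : (fun y => centered y i 0 : R^o) = fun y => y (lift ord0 i) 0 - cst
    (2^-1 : R^o) y.
  by apply/funext => y; rewrite mxE.
by apply: (is_diff_eq d); apply/funext => v; exact: subr0.
Qed.

Lemma diff_centered z v : 'd centered z v = \col_j v (lift ord0 j) 0.
Proof.
have cd := Ck_differentiable (@Ck_centered 1) (I : setT z).
apply/colP => i; rewrite [RHS]mxE.
apply: (etrans (esym (diff_entry v i 0 cd))).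
exact: (congr1 (@^~ v) (@diff_val _ _ _ _ _ _ _ (is_diff_centered_entry z i))).
Qed.

Lemma diff_contraction z v :
  'd contraction z v = v ord0 0 *: centered z + z ord0 0 *: 'd centered z v.
Proof.
have cd := Ck_differentiable (@Ck_contraction 1) (I : setT z).
apply/colP => i; apply: (etrans (esym (diff_entry v i 0 cd))).
have d := is_diff_mul (is_diff_coord z ord0 0) (is_diff_centered_entry z i).
have -> : (fun y => contraction y i 0 : R^o) = fun y => y ord0 0 * centered y i
    0.
  by apply/funext => y; rewrite !mxE.
apply: (etrans (congr1 (@^~ v) (@diff_val _ _ _ _ _ _ _ d))).
by rewrite diff_centered !mxE.
Qed.

End Contraction.

Section Pullback.
Variables (R : realType) (V : normedModType R) (m N : nat).
Variables (Q : 'cV[R]_m.+1 -> 'M[R]_N.+1) (h : V -> 'cV[R]_m.+1).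
Hypotheses (QC : Ck 2 setT Q) (hC : Ck 2 setT h).

Lemma Ck_pullback : Ck 2 setT (fun z => Q (h z)).
Proof. exact: (Ck_comp openT openT (fun _ _ => I) hC QC). Qed.

Lemma curv_pullback u v z :
  curv (fun z => Q (h z)) u v z = curv Q ('d h z u) ('d h z v) (h z).
Proof.
have hd := Ck_differentiable hC (I : setT z).
have Qd := Ck_differentiable QC (I : setT (h z)).
have E w : 'd (fun z => Q (h z)) z w = 'd Q (h z) ('d h z w).
  exact: (congr1 (@^~ w) (diff_comp hd Qd)).
by rewrite /curv !E.
Qed.

End Pullback.

Section Contradiction.
Variables (R : realType) (nabla : connection R 6).
Hypothesis nablaP : levi_civita nabla.
Variable J : sphere R 6 -> 'M[R]_7.
Hypothesis JP : almost_complex_structure J.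
Hypothesis commJ : forall (p : sphere R 6) (X : 'cV[R]_7), tangent p X ->
  forall A B : 'M[R]_7, is_covariant_derivative nabla J p X A ->
    is_covariant_derivative nabla J p (J p *m X) B -> A *m B = B *m A.
Local Notation e i := (delta_mx i 0 : 'cV[R]_7).
Local Notation density := (cube_density J).

Definition contracted_form (z : 'cV[R]_7) i j : R :=
  curv (fun z => stab_chart J (contraction z)) (e i) (e j) z.
Definition static_form (z : 'cV[R]_7) i j : R :=
  curv (fun z => stab_chart J (centered z)) (e i) (e j) z.

Lemma diff_centered_frame z i : 'd (@centered R) z (e i) = frame R i.
Proof.
by rewrite diff_centered; apply/colP => j; rewrite !mxE andbT eq_sym.
Qed.

Lemma diff_contraction_frame z i : i != ord0 ->
  'd (@contraction R) z (e i) = z ord0 0 *: frame R i.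
Proof.
move=> i0; apply: (etrans (diff_contraction z (e i))).
have -> : (e i) ord0 0 = 0 by rewrite mxE eq_sym (negbTE i0).
by apply: (etrans (congr1 (fun u => 0 *: _ + _ *: u)
    (diff_centered_frame z i)));
  rewrite scale0r add0r.
Qed.

Lemma static_formE z i j : static_form z i j = omega7 J (centered z) i j.
Proof.
by rewrite /static_form (curv_pullback (Ck_stab_chart JP) (@Ck_centered R 2))
    !diff_centered_frame.
Qed.

Lemma contracted_formE z i j : i != ord0 -> j != ord0 ->
  contracted_form z i j = curv (stab_chart J) (z ord0 0 *: frame R i)
      (z ord0 0 *: frame R j)
    (contraction z).
Proof.
move=> i0 j0; rewrite /contracted_form
    (curv_pullback (Ck_stab_chart JP) (@Ck_contraction R 2)).
by rewrite !diff_contraction_frame.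
Qed.

Lemma flux_top (z : 'cV[R]_7) : z ord0 0 = 1 ->
  flux (contracted_form z) (static_form z) ord0 = density (centered z).
Proof.
move=> z1; rewrite (flux_first (a' := omega7 J (centered z))
    (b' := omega7 J (centered z))).
- by rewrite /flux.
- by move=> i j i0 j0; rewrite contracted_formE// z1 /contraction z1 !scale1r.
- by move=> i j _ _; exact: static_formE.
Qed.

Lemma flux_bottom (z : 'cV[R]_7) : z ord0 0 = 0 -> flux (contracted_form z)
    (static_form z) ord0 = 0.
Proof.
move=> z0; rewrite (flux_first (a' := fun _ _ => 0) (b' := static_form z))
    ?flux_l0//.
by move=> i j i0 j0; rewrite contracted_formE// z0 !scale0r /curv linear0 mulmx0
    linear0.
Qed.

(** On these faces the chart is constant near the projected point, and the
    static form is zero. *)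
Lemma flux_side (i : 'I_7) (z : 'cV[R]_7) : i != ord0 -> z i 0 = 0 \/ z i 0 = 1
    ->
  flux (contracted_form z) (static_form z) i = 0.
Proof.
move=> i0 zi; apply: flux_r0 => j k; rewrite static_formE; apply: omega_outside
    => //.
case: (unliftP ord0 i) i0 zi => [l ->|->]; last by rewrite eqxx.
move=> _ zl; have : 4^-1 <= dot (centered z) (centered z).
  rewrite /dot (bigD1 l) //= -[leLHS]addr0 lerD//; last first.
    by apply: sumr_ge0 => q _; rewrite -expr2 sqr_ge0.
  by rewrite !mxE; case: zl => ->; lra.
by lra.
Qed.

Lemma density_outside x : 1 - 5 * dot x x <= 0 -> density x = 0.
Proof.
move=> s0; have W i j : omega7 J x i j = 0 by exact: omega_outside.
by rewrite /cube_density /wedge24 /pf4 !W !mul0r !subr0 !addr0.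
Qed.

Lemma density_continuous : continuous (density : 'cV[R]_6 -> R^o).
Proof.
move=> x; have a i j : Ck 1 setT (fun y => omega7 J y i j : R^o).
  exact: (curv_Ck1 (Ck_stab_chart JP)).
exact: (Ck_continuous (Ck_wedge24 a a _ _ _ _ _ _)).
Qed.

Let gap_scale (t d : R) : 0 <= t -> t <= 1 -> 0 <= d -> 0 < 1 - 5 * d ->
  0 < 1 - 5 * (t * (t * d)).
Proof.
move=> t0 t1 d0 gap; have : t * (t * d) <= d.
  by rewrite mulrA -[leRHS]mul1r ler_wpM2r// mulr_ile1.
by lra.
Qed.

(** The density is continuous without zeros on the ball, which is star-shaped
    around the origin, and is zero outside. *)
Lemma density_sign x : 0 <= density 0 * density x.
Proof.
case: (leP (1 - 5 * dot x x) 0) => [/density_outside ->|s0]; first by rewrite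
    mulr0.
rewrite leNgt; apply/negP => neg.
pose g (t : R) : R := density 0 * density (t *: x).
have gc : {within `[0, 1], continuous g}.
  apply: continuous_subspaceT => t; apply: cvgM; first exact: cvg_cst.
  have c : {for t, continuous (fun t : R => t *: x)}.
    by apply: continuousZr_tmp; exact: cvg_id.
  exact: (@continuous_comp R 'cV[R]_6 R^o (fun t => t *: x) density t c
    (@density_continuous (t *: x))).
have g0 : 0 < g 0.
  rewrite /g scale0r -expr2 exprn_even_gt0//=; apply:
      (cube_density_neq0 nablaP JP commJ).
  by rewrite /dot big1 ?mulr0 ?subr0// => i _; rewrite !mxE mulr0.
have g1 : g 1 < 0 by rewrite /g scale1r.
have gE t : g t = density 0 * density (t *: x) by [].
clearbody g; have g01 : Num.min (g 0) (g 1) <= 0 <= Num.max (g 0) (g 1).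
  by rewrite ge_min le_max (ltW g1) (ltW g0) orbT.
have [t] := @IVT R g 0 1 0 ler01 gc g01.
rewrite in_itv /= gE => /andP[t0 t1] /eqP.
have tx : 0 < 1 - 5 * dot (t *: x) (t *: x).
  by rewrite dotZl dotZr; apply: gap_scale; rewrite ?dot_ge0.
apply/negP; rewrite mulf_neq0 //; first by apply: contraTneq g0 => d0; rewrite
    gE d0 mul0r ltxx.
exact: (cube_density_neq0 nablaP JP commJ tx).
Qed.

(** The factor density 0 normalises the sign of omega ^ 3. *)
Lemma commuting_derivatives_absurd : False.
Proof.
pose W i z : R^o := density 0 * flux (contracted_form z) (static_form z) i.
have aC i j : Ck 1 setT (fun z => contracted_form z i j : R^o).
  exact: (curv_Ck1 (Ck_pullback (Ck_stab_chart JP) (@Ck_contraction R 2))).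
have bC i j : Ck 1 setT (fun z => static_form z i j : R^o).
  exact: (curv_Ck1 (Ck_pullback (Ck_stab_chart JP) (@Ck_centered R 2))).
have fC i : Ck 1 setT (fun z => flux (contracted_form z) (static_form z) i :
    R^o) := Ck_flux i aC bC.
have WC i : Ck 1 setT (W i).
  have c : Ck 1 setT (fun=> density 0 : R^o) := @Ck_cst R 'cV[R]_7 R^o 1 setT
      (density 0).
  exact: (CkM openT c (fC i)).
have divW z : \sum_i 'd (W i) z (e i) = 0.
  have acl i j k : 'd (fun y => contracted_form y j k : R^o) z (e i) -
      'd (fun y => contracted_form y i k : R^o) z (e j) +
      'd (fun y => contracted_form y i j : R^o) z (e k) = 0.
    apply: (curv_closed (Ck_pullback (Ck_stab_chart JP) (@Ck_contraction R 2))).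
    by move=> y; exact: stab_chart_sq JP _.
  have bcl i j k : 'd (fun y => static_form y j k : R^o) z (e i) -
      'd (fun y => static_form y i k : R^o) z (e j) +
      'd (fun y => static_form y i j : R^o) z (e k) = 0.
    apply: (curv_closed (Ck_pullback (Ck_stab_chart JP) (@Ck_centered R 2))).
    by move=> y; exact: stab_chart_sq JP _.
  have D := divergence_flux (fun i j => Ck_differentiable (aC i j) (I : setT z))
    (fun i j => Ck_differentiable (bC i j) (I : setT z)) acl bcl.
  have E i : 'd (W i) z (e i) =
      density 0 * 'd (fun y => flux (contracted_form y) (static_form y) i : R^o)
          z (e i).
    have d := is_diff_mul (is_diff_cst (density 0 : R^o) z)
      (differentiableP (Ck_differentiable (fC i) (I : setT z))).
    apply: (etrans (congr1 (@^~ (e i)) (@diff_val _ _ _ _ _ _ _ d))).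
    by rewrite mul0r add0r.
  apply: (etrans (eq_bigr _ (fun i _ => E i))).
  by apply: (etrans (esym (mulr_sumr _ _ _ _))); rewrite D mulr0.
have K := divergence_free_face WC divW.
have : W ord0 (face_center R 6) = 0.
  apply: K.
  - by move=> i z i0 zi; rewrite /W flux_side// mulr0.
  - by move=> z z0; rewrite /W flux_bottom// mulr0.
  - by move=> z z1; rewrite /W flux_top//; exact: density_sign.
rewrite /W flux_top; last by rewrite mxE.
have -> : centered (face_center R 6) = 0.
  by apply/colP => j; rewrite !mxE eq_sym (negbTE (neq_lift _ _)) subrr.
apply/eqP; rewrite mulf_neq0//; apply: (cube_density_neq0 nablaP JP commJ);
  by rewrite /dot big1 ?mulr0 ?subr0// => i _; rewrite !mxE mulr0.
Qed.

End Contradiction.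

Theorem corollary4p5 (R : realType) (nabla : connection R 6)
    (nablaP : levi_civita nabla) :
  ~ exists J : sphere R 6 -> 'M[R]_7,
      almost_complex_structure J /\
      forall (p : sphere R 6) (X : 'cV[R]_7), tangent p X ->
      forall A B : 'M[R]_7,
        is_covariant_derivative nabla J p X A ->
        is_covariant_derivative nabla J p (J p *m X) B ->
        A *m B = B *m A.
Proof.
by move=> [J [JP commJ]]; exact: (commuting_derivatives_absurd nablaP JP commJ).
Qed.
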